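(* Let $\dot{H}$ be a totally disconnected graph of order $s$, and let $\dot{\mathscr{B}}_m$ be the maximal signed bipartite graph with $\dot{H}$ as a star complement for an eigenvalue $\mu$, where $s=\mu^2\geq 2$. (1) If $s\in 2\mathbb{Z}^{+}+1$, then $\dot{\mathscr{B}}_m\cong^s (K_{1,s},\emptyset)$. (2) If $s\in 2\mathbb{Z}^{+}\setminus 4\mathbb{Z}^{+}$, then $\dot{\mathscr{B}}_m\cong^s \big(K_{2,s},E(K_{1,\frac{s}{2}})\big)$. (3) If $s\in \mathcal{N}(\mathcal{H})$, then $\dot{\mathscr{B}}_m\cong^s SRG^{s}(2s)$, i.e. $\dot{\mathscr{B}}_m$ is switching isomorphic to a bipartite signed strongly regular graph with parameters $SRG^s(2s,s,0,0,0)$.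
   Context: A signed graph is a pair $(G,\Sigma^-)$ where $G$ is a finite simple graph (the underlying graph) and $\Sigma^-\subseteq E(G)$ is its set of negative edges; its adjacency matrix has entry $1$ for positive edges, $-1$ for negative edges and $0$ otherwise; its eigenvalues are those of this matrix. It is bipartite if $G$ is. The totally disconnected (signed) graph of order $s$ is $(sK_1,\emptyset)$, with $s$ vertices and no edges. If $\mu$ is an eigenvalue of a signed graph $(G,\Sigma^-)$ of multiplicity $k$, a star set for $\mu$ is a set $S\subseteq V(G)$ with $|S|=k$ such that $\mu$ is not an eigenvalue of the induced signed subgraph $(G,\Sigma^-)-S$; then $(G,\Sigma^-)-S$ is called a star complement for $\mu$ in $(G,\Sigma^-)$. ''Maximal'' means: of maximum order among all signed bipartite graphs with $\dot{H}$ as a star complement for $\mu$. Two signed graphs are isomorphic if their adjacency matrices satisfy $A_2=P^{-1}A_1P$ for a permutation matrix $P$, and switching equivalent if $A_2=D^{-1}A_1D$ for a diagonal matrix $D$ with diagonal entries $\pm1$. They are switching isomorphic, written $\cong^s$, if one is isomorphic to a signed graph switching equivalent to the other. In $(K_{2,s},E(K_{1,s/2}))$ the negative edges form a star $K_{1,s/2}$ centred at a vertex of the part of size $2$. $\mathcal{N}(\mathcal{H})$ is the set of natural numbers $m$ having at least one of the following forms (each known to be the order of a Hadamard matrix): (i) $m=2^a$, $a\geq 1$; (ii) $m=2^a(r^h+1)$, $a\geq 2$, $h\geq 1$, $r$ a prime; (iii) $m=2^a r(r+1)$, $a\geq 2$, $r\equiv 3 \pmod 4$ a prime; (iv) $m=r+1$,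 $r\equiv 3\pmod 4$ a prime power; (v) $m=2(r+1)$, $r\equiv 1\pmod 4$ a prime power. The sign of a walk is the product of the signs of its edges; $w_2(u,v)$ is the number of positive walks of length $2$ between $u$ and $v$ minus the number of negative ones. A signed graph on $n$ vertices is strongly regular with parameters $SRG^s(n,r,a,b,c)$ if its underlying graph is regular of degree $r$, it is neither homogeneous complete (complete with all edges of the same sign) nor totally disconnected, and there are integers $a,b,c$ such that $w_2(u,v)=a$ for every positive edge $uv$, $w_2(u,v)=b$ for every negative edge $uv$, and $w_2(u,v)=c$ for all distinct non-adjacent $u,v$. The superscript $s$ in $SRG^s$ stands for ''signed'' and is unrelated to the order $s$. $SRG^s(2n)$ denotes $SRG^s(2n,n,0,0,0)$ and is taken to be bipartite. *)

(* Defs.v *)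
From mathcomp Require Import all_boot all_order all_fingroup all_algebra.

Set Implicit Arguments.
Unset Strict Implicit.
Unset Printing Implicit Defensive.

Import GRing.Theory.
Local Open Scope ring_scope.

(* [edge] is the adjacency relation of the underlying simple graph and [neg]
   is its set of negative edges, as a symmetric subrelation. *)
Record signed_graph (n : nat) := SignedGraph {
  edge : rel 'I_n;
  neg : rel 'I_n;
  edge_sym : symmetric edge;
  edge_irr : irreflexive edge;
  neg_sym : symmetric neg;
  neg_edge : subrel neg edge
}.

Definition adjmx (R : pzRingType) n (G : signed_graph n) : 'M[R]_n :=
  \matrix_(i, j) (if neg G i j then -1 else (edge G i j)%:R).

Definition bipartite n (G : signed_graph n) : Prop :=
  exists c : 'I_n -> bool, forall x y, edge G x y -> c x != c y.

Definition totally_disconnected n (G : signed_graph n) : Prop :=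
  forall x y, ~~ edge G x y.

Section Induced.
Variables (n : nat) (G : signed_graph n) (A : {set 'I_n}).

Let e : rel 'I_#|A| := relpre enum_val (edge G).
Let m : rel 'I_#|A| := relpre enum_val (neg G).

Fact induced_edge_sym : symmetric e.
Proof. by move=> x y; apply: edge_sym. Qed.

Fact induced_edge_irr : irreflexive e.
Proof. by move=> x; apply: edge_irr. Qed.

Fact induced_neg_sym : symmetric m.
Proof. by move=> x y; apply: neg_sym. Qed.

Fact induced_neg_edge : subrel m e.
Proof. by move=> x y; apply: neg_edge. Qed.

(* The vertices of A are relabelled 0, ..., #|A|-1 through [enum_val]. *)
Definition induced : signed_graph #|A| :=
  SignedGraph induced_edge_sym induced_edge_irr
              induced_neg_sym induced_neg_edge.

End Induced.

(* The existential on [n1 = n2] only serves to compare matrices whose formal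
   sizes differ syntactically. *)
Definition isomorphic n1 n2 (G1 : signed_graph n1) (G2 : signed_graph n2) :
    Prop :=
  exists (e : n1 = n2) (p : 'S_n2),
    adjmx int G2 =
      invmx (perm_mx p) *m castmx (e, e) (adjmx int G1) *m perm_mx p.

Definition switching_equivalent n (G1 G2 : signed_graph n) : Prop :=
  exists2 d : 'rV[int]_n, (forall i, d 0 i = 1 \/ d 0 i = -1) &
    adjmx int G2 = invmx (diag_mx d) *m adjmx int G1 *m diag_mx d.

Definition switching_isomorphic n1 n2
    (G1 : signed_graph n1) (G2 : signed_graph n2) : Prop :=
  exists2 G : signed_graph n2, switching_equivalent G2 G & isomorphic G1 G.

(* The number of vertices in a star set is the multiplicity of the eigenvalue
   as a root of the characteristic polynomial. *)
Definition star_set (F : fieldType) n (G : signed_graph n) (mu : F)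
    (S : {set 'I_n}) : Prop :=
  [/\ eigenvalue (adjmx F G) mu,
      #|S| = mup mu (char_poly (adjmx F G))
    & ~~ eigenvalue (adjmx F (induced G (~: S))) mu].

Definition has_star_complement (F : fieldType) n s (G : signed_graph n)
    (H : signed_graph s) (mu : F) : Prop :=
  exists2 S : {set 'I_n}, star_set G mu S & isomorphic (induced G (~: S)) H.

Definition maximal_bipartite (F : fieldType) n s (G : signed_graph n)
    (H : signed_graph s) (mu : F) : Prop :=
  [/\ bipartite G, has_star_complement G H mu
    & forall n' (G' : signed_graph n'),
        bipartite G' -> has_star_complement G' H mu -> (n' <= n)%N].

Section CompleteBipartite.
Variables (p q : nat) (N : 'I_p -> 'I_q -> bool).

Let e (x y : 'I_(p + q)) : bool :=
  match split x, split y with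
  | inl _, inr _ | inr _, inl _ => true
  | _, _ => false
  end.
Let m (x y : 'I_(p + q)) : bool :=
  match split x, split y with
  | inl i, inr j | inr j, inl i => N i j
  | _, _ => false
  end.

Fact Kpq_edge_sym : symmetric e.
Proof. by move=> x y; rewrite /e; case: split; case: split. Qed.

Fact Kpq_edge_irr : irreflexive e.
Proof. by move=> x; rewrite /e; case: split. Qed.

Fact Kpq_neg_sym : symmetric m.
Proof. by move=> x y; rewrite /m; case: split; case: split. Qed.

Fact Kpq_neg_edge : subrel m e.
Proof. by move=> x y; rewrite /m /e; case: split; case: split. Qed.

(* K_{p,q} whose parts are indexed by 'I_p and 'I_q, the edge between i and j
   being negative when N i j holds. *)
Definition signed_Kpq : signed_graph (p + q) :=
  SignedGraph Kpq_edge_sym Kpq_edge_irr Kpq_neg_sym Kpq_neg_edge.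

End CompleteBipartite.

(* (K_{1,s}, empty set) *)
Definition positive_star (s : nat) : signed_graph (1 + s) :=
  signed_Kpq (fun (_ : 'I_1) (_ : 'I_s) => false).

(* (K_{2,s}, E(K_{1,s/2})), the negative star being centred at vertex 0 of the
   part of size 2. *)
Definition K2s_half_star (s : nat) : signed_graph (2 + s) :=
  signed_Kpq (fun (i : 'I_2) (j : 'I_s) => (i == 0 :> nat)%N && (j < s./2)%N).

Definition w2 n (G : signed_graph n) (u v : 'I_n) : int :=
  #|[set z | [&& edge G u z, edge G z v & neg G u z == neg G z v]]|%:Z
  - #|[set z | [&& edge G u z, edge G z v & neg G u z != neg G z v]]|%:Z.

Definition homogeneous_complete n (G : signed_graph n) : Prop :=
  (forall x y, x != y -> edge G x y) /\
  ((forall x y, edge G x y -> ~~ neg G x y) \/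
   (forall x y, edge G x y -> neg G x y)).

Definition strongly_regular n (G : signed_graph n) (r : nat) (a b c : int) :
    Prop :=
  [/\ forall x, #|[set y | edge G x y]| = r,
      ~ homogeneous_complete G /\ ~ totally_disconnected G,
      forall u v, edge G u v -> ~~ neg G u v -> w2 G u v = a,
      forall u v, neg G u v -> w2 G u v = b
    & forall u v, u != v -> ~~ edge G u v -> w2 G u v = c].

Definition prime_power (q : nat) : Prop :=
  exists p k, [/\ prime p, (0 < k)%N & q = (p ^ k)%N].

Local Open Scope nat_scope.

Inductive in_NH (m : nat) : Prop :=
| NH_pow2 a of 1 <= a & m = 2 ^ a
| NH_pow2_prime_pow a h r of 2 <= a & 1 <= h & prime r & m = 2 ^ a * (r ^ h + 1)
| NH_pow2_prime_prod a r of
    2 <= a & prime r & r %% 4 = 3 & m = 2 ^ a * (r * (r + 1))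
| NH_paley1 r of prime_power r & r %% 4 = 3 & m = r + 1
| NH_paley2 r of prime_power r & r %% 4 = 1 & m = 2 * (r + 1).

(* Main.v *)
Require Import Defs.
From mathcomp Require Import all_boot all_order all_fingroup all_algebra all_field.
From mathcomp Require Import complex.
From mathcomp Require Import ring zify.

(** Let S be a star set of B for mu whose complement is the edgeless graph on
    s = mu^2 vertices.  Real symmetric matrices are diagonalizable, so the
    eigenspace of mu has dimension #|S|; since mu is not an eigenvalue of the
    complement, the eigenvectors of mu can be prescribed on S.  Reading off
    their remaining coordinates gives the reconstruction formula: for u and v
    in S, with a the adjacency matrix,
      mu^2 [u = v] = mu a(u, v) + sum over t outside S of a(u, t) a(v, t).
    For u = v it says that u is joined to all s vertices of the complement.
    When B is bipartite, two vertices of S therefore have a common neighbour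
    and are not adjacent, and for u <> v the formula says that their rows of
    signs are orthogonal.  Hence B is a signed K_{k,s} whose k rows of signs are
    pairwise orthogonal (star_complement_signed_Kpq).  Conversely, every such
    signed K_{k,s} with k > 0 has the edgeless graph as a star complement for mu
    (has_star_complement_signed_Kpq), because its characteristic polynomial p
    satisfies p X^k = (X^2 - s)^k X^s.  So B is maximal exactly when k is the
    largest number of pairwise orthogonal vectors of signs of length s.

    Two orthogonal vectors of signs force s to be even and three force 4 to
    divide s, so k = 1 for odd s and k = 2 for s = 2 mod 4; switching, together
    with a permutation of the columns when k = 2, then brings B to the
    announced form.  Always k <= s, with equality when there is a Hadamard
    matrix of order s.  In that case the adjacency matrix A of B satisfies
    A^2 = s I, which is strong regularity with parameters (2s, s, 0, 0, 0).

    It remains to produce Hadamard matrices of all the listed orders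
    (in_NH_hadamard_order).  Doubling provides the powers of two, and the
    quadratic character of a finite field of order q provides the two Paley
    constructions, of orders q + 1 for q = 3 mod 4 and 2(q + 1) for q = 1 mod 4.
    For r a prime that is 3 mod 4, a construction of Scarpis turns the Paley
    matrix of order r + 1 into one of order r(r + 1).  The orders 2^a (r^h + 1)
    follow from Paley's when r is odd.  When r = 2 they need Hadamard matrices
    of order 4(2^h + 1); Turyn's sequences built from Golay pairs supply four
    circulant matrices, which the Goethals-Seidel array assembles. *)

Set Implicit Arguments.
Unset Strict Implicit.
Unset Printing Implicit Defensive.

Import Order.TTheory GRing.Theory Num.Theory.
Local Open Scope ring_scope.

(** * Multiplicities of eigenvalues of symmetric matrices *)

Lemma char_poly_conj (F : fieldType) n (P D : 'M[F]_n) :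
  P \in unitmx -> char_poly (invmx P *m D *m P) = char_poly D.
Proof.
move=> uP; rewrite /char_poly /char_poly_mx.
have -> : 'X%:M - map_mx polyC (invmx P *m D *m P) =
   map_mx polyC (invmx P) *m ('X%:M - map_mx polyC D) *m map_mx polyC P.
  rewrite mulmxBr mulmxBl !map_mxM; congr (_ - _).
  by rewrite scalar_mxC -mulmxA -map_mxM mulVmx // map_scalar_mx /= mulmx1.
rewrite !det_mulmx mulrC mulrA -det_mulmx -map_mxM mulmxV //.
by rewrite map_scalar_mx det1 mul1r.
Qed.

Lemma rank_diag_mx_le (F : fieldType) n (d : 'rV[F]_n) :
  (\rank (diag_mx d) <= #|[set i | d 0%R i != 0%R]|)%N.
Proof.
pose V := (\sum_(i | d 0 i != 0) <<delta_mx 0 i : 'rV[F]_n>>)%MS.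
have sub : (diag_mx d <= V)%MS.
  apply/row_subP=> i; rewrite row_diag_mx.
  have [-> | di] := eqVneq (d 0 i) 0; first by rewrite scale0r sub0mx.
  by rewrite scalemx_sub // (sumsmx_sup i) ?genmxE.
apply: leq_trans (mxrankS sub) _.
apply: leq_trans (mxrank_sum_leqif _).1 _.
rewrite -sum1dep_card /= big_mkcond [leqRHS]big_mkcond leq_sum // => i _.
by case: ifP => // _; rewrite genmxE mxrank_delta.
Qed.

(** The algebraic multiplicity does not exceed the geometric one.  The
    matrix is diagonalized over R[i], where the spectral theorem is
    available; both multiplicities are insensitive to this extension. *)
Lemma symmetric_mup_le_rank_eigenspace (R : rcfType) n (A : 'M[R]_n) (mu : R) :
  A^T = A -> (mup mu (char_poly A) <= \rank (eigenspace A mu))%N.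
Proof.
move=> symA; pose f := real_complex R; pose B := map_mx f A.
have nB : B \is normalmx.
  apply/hermitian_normalmx/realsym_hermsym.
    by apply/is_hermitianmxP; rewrite expr0 scale1r map_mx_id // map_trmx symA.
  by apply/mxOverP => i j; rewrite mxE /f /= complex_real.
have := orthomx_spectralP nB.
set P := spectralmx B; set d := spectral_diag B => eqB.
have uP : P \in unitmx by apply: spectral_unit.
have charB : char_poly B =
    \prod_(x <- [seq d 0 i | i <- enum 'I_n]) ('X - x%:P).
  rewrite eqB char_poly_conj // char_poly_trig ?diag_mx_is_trig //.
  rewrite big_map big_enum /=; apply: eq_bigr => i _.
  by rewrite mxE eqxx mulr1n.
have mupB : (mup mu (char_poly A) <= mup (f mu) (char_poly B))%N.
  rewrite mup_geq ?monic_neq0 ?char_poly_monic // -map_char_poly.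
  have -> : ('X - (f mu)%:P) = map_poly f ('X - mu%:P).
    by rewrite rmorphB /= map_polyX map_polyC.
  rewrite -rmorphXn dvdp_map -mup_geq ?monic_neq0 ?char_poly_monic //.
apply: leq_trans mupB _.
rewrite -(mxrank_map f) map_kermx mxrank_ker map_mxB map_scalar_mx -/B.
have -> : B - (f mu)%:M = invmx P *m diag_mx (d - const_mx (f mu)) *m P.
  rewrite linearB /= diag_const_mx mulmxBr mulmxBl -eqB; congr (_ - _).
  by rewrite scalar_mxC -mulmxA mulVmx // mulmx1.
rewrite charB mu_prod_XsubC count_map.
have -> : count (preim (fun i => d 0 i) (pred1 (f mu))) (enum 'I_n) =
          #|[set i | d 0 i == f mu]|.
  by rewrite -sum1dep_card -sum1_count big_enum_cond.
rewrite leq_subRL; last exact: rank_leq_row.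
rewrite -[n in (_ <= n)%N]card_ord -(cardsC [set i | d 0 i == f mu]) addnC leq_add2l.
apply: leq_trans (mxrankM_maxl _ _) _; apply: leq_trans (mxrankM_maxr _ _) _.
apply: leq_trans (rank_diag_mx_le _) _.
rewrite subset_leq_card //; apply/subsetP => i.
by rewrite !inE !mxE subr_eq0.
Qed.

(** * Adjacency matrices of signed graphs *)

Lemma adjmx_sym (R : pzRingType) n (G : signed_graph n) i j :
  adjmx R G i j = adjmx R G j i.
Proof. by rewrite !mxE neg_sym edge_sym. Qed.

Lemma adjmxNe (R : pzRingType) n (G : signed_graph n) i j :
  ~~ edge G i j -> adjmx R G i j = 0.
Proof.
move=> /negbTE nij; rewrite mxE nij; case: ifP => // /neg_edge.
by rewrite nij.
Qed.

Lemma adjmx_sqr (R : pzRingType) n (G : signed_graph n) i j :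
  adjmx R G i j * adjmx R G i j = (edge G i j)%:R.
Proof.
rewrite mxE; case: ifP => [/neg_edge ->|_]; first by rewrite mulrNN mulr1.
by case: edge; rewrite ?mulr1 ?mulr0.
Qed.

Lemma adjmx_intr (R : pzRingType) n (G : signed_graph n) i j :
  adjmx R G i j = (adjmx int G i j)%:~R.
Proof. by rewrite !mxE; case: neg; rewrite ?mulrN1z //; case: edge. Qed.

Lemma totally_disconnectedP n (G : signed_graph n) :
  totally_disconnected G <-> adjmx int G = 0.
Proof.
split=> [dG | A0 x y]; first by apply/matrixP=> i j; rewrite adjmxNe ?mxE.
apply/negP => exy; have := adjmx_sqr int G x y.
by rewrite A0 exy mxE mul0r.
Qed.

Lemma isomorphic_totally_disconnected n1 n2 (G : signed_graph n1)
    (H : signed_graph n2) :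
  totally_disconnected H ->
  isomorphic G H <-> n1 = n2 /\ totally_disconnected G.
Proof.
move=> dH; split=> [[e [p]]|[e dG]].
  move/totally_disconnectedP: (dH) ->; destruct e.
  rewrite castmx_id => E; split=> //; apply/totally_disconnectedP.
  have up := unitmx_perm int p.
  by rewrite -[LHS](mulKVmx up) -[X in _ *m X](mulmxK up) -E mul0mx mulmx0.
exists e, 1%g; destruct e; rewrite castmx_id.
by move/totally_disconnectedP: dH ->; move/totally_disconnectedP: dG ->;
   rewrite mulmx0 mul0mx.
Qed.

Lemma totally_disconnected_induced n (G : signed_graph n) (A : {set 'I_n}) :
  totally_disconnected (induced G A) <->
  {in A &, forall x y, ~~ edge G x y}.
Proof.
split=> [dG x y xA yA | dG x y]; last by apply: dG; apply: enum_valP.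
have := dG (enum_rank_in xA x) (enum_rank_in xA y).
by rewrite /= !enum_rankK_in.
Qed.

Lemma w2E n (G : signed_graph n) u v :
  w2 G u v = (adjmx int G *m adjmx int G) u v.
Proof.
rewrite mxE /w2 -!natz -!sum1dep_card !natr_sum.
rewrite [X in X - _]big_mkcond [X in _ - X]big_mkcond /= -sumrB.
apply: eq_bigr => z _; rewrite !mxE.
case nuz: (neg G u z); case nzv: (neg G z v);
  rewrite ?(neg_edge nuz) ?(neg_edge nzv) ?andbT ?andbF //=.
- by case: (edge G z v).
- by case: (edge G u z).
- by case: (edge G u z); case: (edge G z v).
Qed.

(** The entries of A^2 are the numbers w2, and its diagonal gives the
    degrees. *)
Lemma adjmx_sqr_strongly_regular n (G : signed_graph n) (s : nat) :
  (0 < n)%N -> (0 < s)%N -> ~ homogeneous_complete G ->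
  adjmx int G *m adjmx int G = s%:R%:M -> strongly_regular G s 0 0 0.
Proof.
move=> n_gt0 s_gt0 nh A2.
have w0 u v : u != v -> w2 G u v = 0 by rewrite w2E A2 mxE => /negbTE ->.
have neq u v : edge G u v -> u != v.
  by apply: contraTneq => ->; rewrite edge_irr.
have deg x : #|[set y | edge G x y]| = s.
  have /matrixP/(_ x x) := A2; rewrite !mxE eqxx mulr1n.
  under eq_bigr => y _ do rewrite (adjmx_sym _ _ y x) adjmx_sqr.
  rewrite -natr_sum -big_mkcond sum1dep_card => /eqP.
  by rewrite eqr_nat => /eqP.
split=> //.
- split=> // td; have := deg (Ordinal n_gt0).
  rewrite (_ : [set _ | _] = set0) ?cards0.
    by move=> s0; rewrite -s0 in s_gt0.
  by apply/setP=> y; rewrite !inE; apply/negbTE/td.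
- by move=> u v /neq nuv _; apply: w0.
- by move=> u v /neg_edge/neq; apply: w0.
- by move=> u v nuv _; apply: w0.
Qed.

(** * Relabelling and switching *)

(** The sign of an edge that is negative when b holds. *)
Definition sgb (b : bool) : int := (-1) ^+ b.

Lemma sgb_addb b c : sgb (b (+) c) = sgb b * sgb c.
Proof. by rewrite /sgb signr_addb. Qed.

Lemma sgb_sqr b : sgb b * sgb b = 1.
Proof. by rewrite -sgb_addb addbb. Qed.

Section Relabel.
Variables (m n : nat) (f : 'I_m -> 'I_n) (G : signed_graph n).

Fact relabel_edge_sym : symmetric (relpre f (edge G)).
Proof. by move=> x y; apply: edge_sym. Qed.

Fact relabel_edge_irr : irreflexive (relpre f (edge G)).
Proof. by move=> x; apply: edge_irr. Qed.

Fact relabel_neg_sym : symmetric (relpre f (neg G)).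
Proof. by move=> x y; apply: neg_sym. Qed.

Fact relabel_neg_edge : subrel (relpre f (neg G)) (relpre f (edge G)).
Proof. by move=> x y; apply: neg_edge. Qed.

(** The signed graph obtained from G by giving the label x to the vertex f x. *)
Definition relabel : signed_graph m :=
  SignedGraph relabel_edge_sym relabel_edge_irr
              relabel_neg_sym relabel_neg_edge.
End Relabel.

Lemma isomorphic_relabel m n (f : 'I_m -> 'I_n) (G : signed_graph n) :
  bijective f -> isomorphic G (relabel f G).
Proof.
move=> bf; have e : n = m by rewrite -(card_ord n) -(bij_eq_card bf) card_ord.
destruct e; pose q := perm (bij_inj bf).
exists erefl, q^-1%g; rewrite castmx_id.
have -> : invmx (perm_mx q^-1%g) = perm_mx q :> 'M[int]_n.
  have u := unitmx_perm int q^-1%g.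
  by rewrite -[RHS]mul1mx -(mulVmx u) -mulmxA -perm_mxM mulVg perm_mx1 mulmx1.
rewrite -row_permE -col_permE; apply/matrixP=> i j.
by rewrite !mxE !permE.
Qed.

(** A relabelling of B followed by a switching at the vertices x with d x. *)
Lemma switching_isomorphic_relabel m n (f : 'I_m -> 'I_n) (d : 'I_m -> bool)
    (B : signed_graph n) (G : signed_graph m) :
  bijective f ->
  (forall x y,
     adjmx int B (f x) (f y) = sgb (d x) * adjmx int G x y * sgb (d y)) ->
  switching_isomorphic B G.
Proof.
move=> bf E; exists (relabel f B); last exact: isomorphic_relabel.
exists (\row_i sgb (d i)) => [i|].
  by rewrite mxE /sgb; case: (d i); [right | left].
set D := diag_mx _.
have DD : D *m D = 1%:M.
  apply/matrixP=> i j; rewrite mul_diag_mx !mxE.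
  by case: eqP => [->|_]; rewrite ?mulr0n ?mulr0 // mulr1n sgb_sqr.
have uD : D \in unitmx by case: (mulmx1_unit DD).
have -> : invmx D = D by rewrite -[LHS]mulmx1 -DD mulmxA mulVmx // mul1mx.
apply/matrixP=> x y; rewrite mul_mx_diag mul_diag_mx mxE [RHS]mxE.
by rewrite [in RHS]mxE [X in X * _ * _]mxE [X in _ * X]mxE -E mxE.
Qed.

(** * Star sets with an edgeless star complement *)

(** For each u in a star set S there is an eigenvector that is 1 at u and 0
    at the other vertices of S. *)
Lemma star_set_eigenvector (R : rcfType) n (G : signed_graph n) (mu : R)
    (S : {set 'I_n}) u :
  star_set G mu S -> u \in S ->
  exists2 x : 'rV[R]_n, x *m adjmx R G = mu *: x &
    {in S, forall v, x 0 v = (v == u)%:R}.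
Proof.
move=> [eigA cardS neigS] uS.
set A := adjmx R G in eigA cardS *.
have symA : A^T = A by apply/matrixP=> i j; rewrite mxE adjmx_sym.
set E := eigenspace A mu.
have rE : (#|S| <= \rank E)%N
  by rewrite cardS; apply: symmetric_mup_le_rank_eigenspace.
(* P restricts vectors to S.  An eigenvector vanishing on S restricts to an
   eigenvector of the star complement, hence is zero; so P is injective on E,
   and onto by dimension. *)
pose P : 'M[R]_(n, #|S|) := \matrix_(i, j) (i == enum_val j)%:R.
have xP (x : 'rV[R]_n) j : (x *m P) 0 j = x 0 (enum_val j).
  rewrite mxE (bigD1 (enum_val j)) //= mxE eqxx mulr1 big1 ?addr0 // => i ni.
  by rewrite mxE (negbTE ni) mulr0.
have capEP : (E :&: kermx P = 0)%MS.
  apply/eqP/rowV0P => x.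
  rewrite sub_capmx => /andP[/eigenspaceP xA /sub_kermxP xP0].
  have xS v : v \in S -> x 0 v = 0.
    by move=> vS; rewrite -(enum_rankK_in vS vS) -xP xP0 mxE.
  have [//|nx] := eqVneq x 0.
  case/negP: neigS; apply/eigenvalueP.
  exists (\row_j x 0 (enum_val j)).
    apply/rowP=> j; rewrite !mxE.
    move/rowP/(_ (enum_val j)): xA; rewrite !mxE => <-.
    rewrite [RHS](bigID (mem S)) /= [X in _ = X + _]big1 ?add0r; last first.
      by move=> i iS; rewrite xS ?mul0r.
    under [RHS]eq_bigl => i do rewrite -in_setC.
    rewrite [RHS]big_enum_val /=; apply: eq_bigr => i _.
    by rewrite !mxE.
  apply: contra nx => /eqP/rowP x0; apply/eqP/rowP=> v; rewrite mxE.
  have [vS|] := boolP (v \in S); first exact: xS.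
  rewrite -in_setC => vS.
  by have := x0 (enum_rank_in vS v); rewrite !mxE enum_rankK_in.
have full : row_full (E *m P).
  rewrite -col_leq_rank; have := mxrank_mul_ker E P.
  by rewrite capEP mxrank0 addn0 => ->.
pose eu : 'rV[R]_#|S| := \row_j (enum_val j == u)%:R.
have /submxP[w Ew] : (eu <= E *m P)%MS.
  exact: submx_full.
exists (w *m E); first by apply/eigenspaceP; apply: submxMl.
move=> v vS; rewrite -(enum_rankK_in vS vS) -xP -mulmxA -Ew mxE.
by rewrite enum_rankK_in.
Qed.

(** The reconstruction formula for an edgeless star complement: the Gram
    matrix of the adjacencies between S and its complement is determined by
    the adjacencies inside S. *)
Lemma star_complement_reconstruction (R : rcfType) n (G : signed_graph n)
    (mu : R) (S : {set 'I_n}) :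
  star_set G mu S -> totally_disconnected (induced G (~: S)) ->
  {in S &, forall u v,
    mu ^+ 2 * (u == v)%:R = mu * adjmx R G u v
      + \sum_(t in ~: S) adjmx R G u t * adjmx R G v t}.
Proof.
move=> stS /totally_disconnected_induced dT u v uS vS.
have [x xA xS] := star_set_eigenvector stS uS.
have sumE y : \sum_i x 0 i * adjmx R G i y =
    adjmx R G u y + \sum_(t in ~: S) x 0 t * adjmx R G t y.
  rewrite (bigID (mem S)) /=; congr (_ + _); last first.
    by apply: eq_bigl => i; rewrite in_setC.
  rewrite (bigD1 u) //= xS // eqxx mul1r.
  rewrite big1 ?addr0 // => i /andP[iS /negbTE ni].
  by rewrite xS // ni mul0r.
(* The eigenvector of u is determined outside S, where there is no edge. *)
have xT t : t \in ~: S -> mu * x 0 t = adjmx R G u t.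
  move=> tS; have := congr1 (fun M : 'rV_n => M 0 t) xA.
  rewrite /= mxE [X in _ = X]mxE => <-.
  rewrite sumE big1 ?addr0 // => i iS.
  by rewrite adjmxNe ?mulr0 // dT.
have := congr1 (fun M : 'rV_n => M 0 v) xA.
rewrite /= mxE [X in _ = X]mxE sumE (xS v vS) eq_sym => E.
rewrite expr2 -mulrA -E mulrDr mulr_sumr; congr (_ + _).
by apply: eq_bigr => t tS; rewrite mulrA xT // (adjmx_sym R G t).
Qed.

(** In a bipartite signed graph both S and its complement are independent,
    they are completely joined, and the rows of signs are orthogonal. *)
Lemma bipartite_star_complement (R : rcfType) n s (G : signed_graph n)
    (H : signed_graph s) (mu : R) (S : {set 'I_n}) :
  totally_disconnected H -> mu ^+ 2 = s%:R -> (0 < s)%N ->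
  bipartite G -> star_set G mu S -> isomorphic (induced G (~: S)) H ->
  [/\ #|~: S| = s, (0 < #|S|)%N,
      {in S &, forall u v, ~~ edge G u v},
      {in ~: S &, forall u v, ~~ edge G u v} &
      {in S & ~: S, forall u t, edge G u t} /\
      {in S &, forall u v, u != v ->
        \sum_(t in ~: S) adjmx int G u t * adjmx int G v t = 0}].
Proof.
move=> dH mu2 s_gt0 [c bip] stS /(isomorphic_totally_disconnected _ dH).
move=> [cT dT]; have rec := star_complement_reconstruction stS dT.
have S_gt0 : (0 < #|S|)%N.
  have [/[!eigenvalue_root_char] rA cS _] := stS.
  by rewrite cS -XsubC_dvd ?dvdp_XsubCl // monic_neq0 // char_poly_monic.
have /totally_disconnected_induced indT := dT.
have full : {in S & ~: S, forall u t, edge G u t}.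
  move=> u t uS tS.
  have := rec u u uS uS; rewrite eqxx mulr1 mu2 adjmxNe ?edge_irr // mulr0 add0r.
  under eq_bigr do rewrite adjmx_sqr.
  move/eqP; rewrite -natr_sum eqr_nat => /eqP sum_s.
  (* u has s neighbours among the s vertices outside S. *)
  apply: contraT => nut; have : (s < s)%N; last by rewrite ltnn.
  rewrite [X in (X < _)%N]sum_s (bigD1 t) //= (negbTE nut) add0n.
  rewrite -[X in (_ < X)%N]cT.
  rewrite (cardD1 t) tS add1n ltnS -sum1_card.
  rewrite (eq_bigl [in [predD1 ~: S & t]]); last by move=> i; rewrite !inE andbC.
  by apply: leq_sum => i _; case: edge.
have indS : {in S &, forall u v, ~~ edge G u v}.
  move=> u v uS vS; apply/negP => /bip cuv.
  have [t tS] : exists t, t \in ~: S by apply/card_gt0P; rewrite cT.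
  (* t is a common neighbour of u and v. *)
  have := bip _ _ (full u t uS tS); have := bip _ _ (full v t vS tS).
  by move: cuv; case: (c u); case: (c v); case: (c t).
split=> //; split=> // u v uS vS nuv.
have := rec u v uS vS; rewrite (negbTE nuv) mulr0 adjmxNe ?indS // mulr0 add0r.
move=> E; apply: (@intr_inj R); rewrite mulr0z E rmorph_sum /=.
by apply: eq_bigr => t _; rewrite rmorphM /= -!adjmx_intr.
Qed.

(** * Signed complete bipartite graphs *)

(** The rows of the sign matrix with a minus sign at (i, j) when N i j holds
    are pairwise orthogonal. *)
Definition orthogonal_rows (I J : finType) (N : I -> J -> bool) : Prop :=
  forall i i', i != i' -> \sum_j sgb (N i j) * sgb (N i' j) = 0.

Lemma split_lshift m n (i : 'I_m) : split (lshift n i) = inl i.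
Proof. exact: (unsplitK (inl i)). Qed.

Lemma split_rshift m n (j : 'I_n) : split (rshift m j) = inr j.
Proof. exact: (unsplitK (inr j)). Qed.

(** The matrix of signs encoded by N, over an arbitrary ring. *)
Definition sign_mx (F : pzRingType) k s (N : 'I_k -> 'I_s -> bool) :
    'M[F]_(k, s) :=
  \matrix_(i, j) (-1) ^+ N i j.

Lemma sign_mx_gram (R : comPzRingType) k s (N : 'I_k -> 'I_s -> bool) :
  orthogonal_rows N -> sign_mx R N *m (sign_mx R N)^T = s%:R%:M.
Proof.
move=> oN; apply/matrixP => i i'; rewrite !mxE.
under eq_bigr do rewrite !mxE.
have [->|ni] := eqVneq i i'.
  under eq_bigr do rewrite -signr_addb addbb.
  by rewrite sumr_const card_ord mulr1n.
have /(congr1 (intr : int -> R)) := oN i i' ni.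
rewrite rmorph_sum mulr0z mulr0n => E; rewrite -[RHS]E; apply: eq_bigr => j _.
by rewrite rmorphM /= /sgb !rmorph_sign.
Qed.

Lemma adjmx_signed_Kpq (F : pzRingType) k s (N : 'I_k -> 'I_s -> bool) :
  adjmx F (signed_Kpq N) = block_mx 0 (sign_mx F N) (sign_mx F N)^T 0.
Proof.
apply/matrixP=> i j; rewrite !mxE /=.
by case: (split i) => i'; rewrite !mxE; case: (split j) => j';
   rewrite ?mxE //; case: (N i' j') || case: (N j' i').
Qed.

Lemma bipartite_signed_Kpq k s (N : 'I_k -> 'I_s -> bool) :
  bipartite (signed_Kpq N).
Proof.
exists (fun x => if split x is inl _ then true else false) => x y /=.
by case: (split x) => ?; case: (split y).
Qed.

(** Multiplying X I - A on the right by [[X I, 0], [M^T, I]] makes it block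
    triangular, with diagonal blocks (X^2 - s) I and X I. *)
Lemma char_poly_block (F : fieldType) k s (M : 'M[F]_(k, s)) :
  M *m M^T = s%:R%:M ->
  char_poly (block_mx 0 M M^T 0) * 'X^k = ('X^2 - s%:R%:P) ^+ k * 'X^s.
Proof.
move=> MMT.
pose Mp := map_mx polyC M.
have E : char_poly_mx (block_mx 0 M M^T 0) *m block_mx 'X%:M 0 Mp^T 1%:M
    = block_mx ('X^2 - s%:R%:P)%:M (- Mp) 0 'X%:M.
  rewrite /char_poly_mx scalar_mx_block map_block_mx opp_block_mx add_block_mx.
  rewrite mulmx_block !map_mx0 oppr0 !addr0 !sub0r /Mp map_trmx.
  rewrite !mulmx0 !mulmx1 !add0r.
  rewrite mulNmx -map_mxM MMT map_scalar_mx /= -scalar_mxM -expr2.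
  rewrite subr0 mulNmx scalar_mxC addNr.
  by rewrite raddfB.
have := congr1 determinant E.
by rewrite det_mulmx det_lblock det_ublock !det_scalar expr1n mulr1.
Qed.

Lemma mup_char_poly_block (F : numFieldType) k s (M : 'M[F]_(k, s)) mu :
  (0 < s)%N -> mu ^+ 2 = s%:R ->
  M *m M^T = s%:R%:M -> mup mu (char_poly (block_mx 0 M M^T 0)) = k.
Proof.
move=> s_gt0 mu2 MMT.
have mu0 : mu != 0 by rewrite -sqrf_eq0 mu2 pnatr_eq0 -lt0n.
have rX m : ~~ root ('X^m : {poly F}) mu.
  by rewrite /root hornerXn expf_eq0 (negbTE mu0) andbF.
have := congr1 (mup mu) (char_poly_block MMT).
rewrite !mupMl // => ->.
have -> : 'X^2 - s%:R%:P = ('X - mu%:P) * ('X - (- mu)%:P).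
  by rewrite -mu2 rmorphXn /= subr_sqr rmorphN /= opprK.
rewrite exprMn mupMl ?mup_XsubCX ?eqxx //.
rewrite rootE horner_exp hornerXsubC opprK expf_eq0 negb_and orbC.
by rewrite -mulr2n mulrn_eq0 (negbTE mu0).
Qed.

(** The part of size k is a star set: mu is a root of the characteristic
    polynomial with multiplicity k, and the other part is edgeless. *)
Lemma has_star_complement_signed_Kpq (R : rcfType) k s (H : signed_graph s)
    (mu : R) (N : 'I_k -> 'I_s -> bool) :
  totally_disconnected H -> mu ^+ 2 = s%:R -> (0 < s)%N -> (0 < k)%N ->
  orthogonal_rows N -> has_star_complement (signed_Kpq N) H mu.
Proof.
move=> dH mu2 s_gt0 k_gt0 oN.
have mu0 : mu != 0 by rewrite -sqrf_eq0 mu2 pnatr_eq0 -lt0n.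
pose S := [set lshift s i | i in 'I_k].
have SC : ~: S = [set rshift k i | i in 'I_s].
  apply/setP=> x; rewrite inE; case: (split_ordP x) => i ->.
    rewrite imset_f //=; apply/esym/negbTE/imsetP => -[j _ /eqP].
    by rewrite eq_lrshift.
  rewrite [RHS]imset_f //; apply/imsetP => -[j _ /eqP].
  by rewrite eq_rlshift.
have cS : #|S| = k by rewrite card_imset ?card_ord //; apply: lshift_inj.
have cSC : #|~: S| = s by rewrite SC card_imset ?card_ord //; apply: rshift_inj.
have dSC : totally_disconnected (induced (signed_Kpq N) (~: S)).
  apply/totally_disconnected_induced => x y; rewrite SC.
  by move=> /imsetP[i _ ->] /imsetP[j _ ->]; rewrite /= !split_rshift.
exists S; last by apply/isomorphic_totally_disconnected.
have mupk : mup mu (char_poly (adjmx R (signed_Kpq N))) = k.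
  rewrite adjmx_signed_Kpq; apply: mup_char_poly_block => //.
  exact: sign_mx_gram.
split; last 2 first.
- by rewrite mupk.
- move/totally_disconnectedP: dSC => A0.
  apply/eigenvalueP => -[x]; rewrite (_ : adjmx R _ = 0).
    rewrite mulmx0 => /esym/eqP; rewrite scaler_eq0 (negbTE mu0) /= => ->.
    by [].
  by apply/matrixP=> i j; rewrite adjmx_intr A0 !mxE.
rewrite eigenvalue_root_char -dvdp_XsubCl XsubC_dvd ?mupk //.
by rewrite monic_neq0 // char_poly_monic.
Qed.

(** A bipartite signed graph with an edgeless star complement is, up to the
    labelling f of its vertices, a signed complete bipartite graph with
    orthogonal rows of signs. *)
Lemma star_complement_signed_Kpq (R : rcfType) n s (B : signed_graph n)
    (H : signed_graph s) (mu : R) :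
  totally_disconnected H -> mu ^+ 2 = s%:R -> (0 < s)%N ->
  bipartite B -> has_star_complement B H mu ->
  exists k (N : 'I_k -> 'I_s -> bool) (f : 'I_(k + s) -> 'I_n),
  [/\ (0 < k)%N, orthogonal_rows N, bijective f &
   forall x y, adjmx int B (f x) (f y) = adjmx int (signed_Kpq N) x y].
Proof.
move=> dH mu2 s_gt0 bip [S stS isoS].
have [cT k_gt0 indS indT [full oS]] :=
  bipartite_star_complement dH mu2 s_gt0 bip stS isoS.
clear stS isoS; subst s.
pose N (i : 'I_#|S|) (j : 'I_#|~: S|) := neg B (enum_val i) (enum_val j).
pose f (x : 'I_(#|S| + #|~: S|)) : 'I_n :=
  match split x with inl i => enum_val i | inr j => enum_val j end.
have fl i : f (lshift _ i) = enum_val i by rewrite /f split_lshift.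
have fr j : f (rshift _ j) = enum_val j by rewrite /f split_rshift.
have lS (i : 'I_#|S|) : enum_val i \in S := enum_valP i.
have rS (j : 'I_#|~: S|) : enum_val j \in ~: S := enum_valP j.
have AN i j : adjmx int B (enum_val i) (enum_val j) = sgb (N i j).
  by rewrite mxE -/(N i j) full // /sgb; case: (N i j).
exists #|S|, N, f; split=> //.
- move=> i i' ni; rewrite -[RHS](oS (enum_val i) (enum_val i')) //; last first.
    by rewrite (inj_eq enum_val_inj).
  by rewrite [RHS]big_enum_val; apply: eq_bigr => j _; rewrite !AN.
- apply: inj_card_bij => [x y|]; last by rewrite !card_ord cardsC card_ord.
  case: (split_ordP x) => i ->; case: (split_ordP y) => j ->;
    rewrite ?fl ?fr => E; try by rewrite (enum_val_inj E).
    by have := rS j; rewrite -E inE lS.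
  by have := rS i; rewrite E inE lS.
move=> x y; rewrite adjmx_signed_Kpq.
case: (split_ordP x) => i ->; case: (split_ordP y) => j ->; rewrite ?fl ?fr.
- by rewrite block_mxEul [RHS]mxE adjmxNe ?indS.
- by rewrite block_mxEur AN mxE.
- by rewrite block_mxEdl adjmx_sym AN !mxE.
- by rewrite block_mxEdr [RHS]mxE adjmxNe ?indT.
Qed.

(** Permuting the part of size s by g and switching at the vertices selected
    by r and c turns the signs N into the signs N'. *)
Lemma switching_isomorphic_signed_Kpq n k s (B : signed_graph n)
    (N N' : 'I_k -> 'I_s -> bool) (f : 'I_(k + s) -> 'I_n)
    (g : 'I_s -> 'I_s) (r : 'I_k -> bool) (c : 'I_s -> bool) :
  bijective f ->
  (forall x y, adjmx int B (f x) (f y) = adjmx int (signed_Kpq N) x y) ->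
  injective g -> (forall i j, N i (g j) = N' i j (+) r i (+) c j) ->
  switching_isomorphic B (signed_Kpq N').
Proof.
move=> bf E ig EN.
pose g' (x : 'I_(k + s)) : 'I_(k + s) :=
  match split x with inl i => lshift s i | inr j => rshift k (g j) end.
pose d (x : 'I_(k + s)) : bool :=
  match split x with inl i => r i | inr j => c j end.
have gl i : g' (lshift _ i) = lshift _ i by rewrite /g' split_lshift.
have gr j : g' (rshift _ j) = rshift _ (g j) by rewrite /g' split_rshift.
have dl i : d (lshift _ i) = r i by rewrite /d split_lshift.
have dr j : d (rshift _ j) = c j by rewrite /d split_rshift.
have bg : bijective g'.
  apply: injF_bij => x y.
  case: (split_ordP x) => i ->; case: (split_ordP y) => j ->; rewrite ?gl ?gr //.
  - by move/eqP; rewrite eq_lrshift.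
  - by move/eqP; rewrite eq_rlshift.
  - by move/rshift_inj/ig ->.
apply: (@switching_isomorphic_relabel _ _ (f \o g') d); first exact: bij_comp.
move=> x y; rewrite /= E !adjmx_signed_Kpq.
case: (split_ordP x) => i ->; case: (split_ordP y) => j ->;
  rewrite ?gl ?gr ?dl ?dr ?block_mxEul ?block_mxEur ?block_mxEdl ?block_mxEdr
    !mxE ?mulr0 ?mul0r //.
  by rewrite EN !signr_addb; ring.
by rewrite EN !signr_addb; ring.
Qed.

(** * Rows of signs that are pairwise orthogonal *)

Section OrthogonalRows.
Variables (I J : finType) (N : I -> J -> bool).
Hypothesis oN : orthogonal_rows N.

Lemma orthogonal_rows2 (i1 i2 : I) : i1 != i2 -> ~~ odd #|J|.
Proof.
move=> /oN E; have : (2 %| #|J|%:Z)%Z.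
  have -> : #|J|%:Z = \sum_j (1 + sgb (N i1 j) * sgb (N i2 j)).
    by rewrite big_split /= E addr0 sumr_const natz.
  by apply: rpred_sum => j _; case: (N i1 j); case: (N i2 j).
by rewrite dvdzE dvdn2.
Qed.

Lemma orthogonal_rows3 (i1 i2 i3 : I) :
  i1 != i2 -> i1 != i3 -> i2 != i3 -> (4 %| #|J|)%N.
Proof.
move=> /oN E12 /oN E13 /oN E23; have : (4 %| #|J|%:Z)%Z; last by rewrite dvdzE.
(* Each factor is 0 or +-2, so every term is divisible by 4. *)
have -> : #|J|%:Z = \sum_j (sgb (N i1 j) + sgb (N i2 j))
                        * (sgb (N i1 j) + sgb (N i3 j)).
  transitivity (\sum_j (1 + sgb (N i1 j) * sgb (N i3 j)
     + sgb (N i1 j) * sgb (N i2 j) + sgb (N i2 j) * sgb (N i3 j))).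
    by rewrite !big_split /= E12 E13 E23 !addr0 sumr_const natz.
  apply: eq_bigr => j _; rewrite -(sgb_sqr (N i1 j)); ring.
by apply: rpred_sum => j _; case: (N i1 j); case: (N i2 j); case: (N i3 j).
Qed.
End OrthogonalRows.

Lemma orthogonal_rows_le k s (N : 'I_k -> 'I_s -> bool) :
  (0 < s)%N -> orthogonal_rows N -> (k <= s)%N.
Proof.
move=> s_gt0 /(sign_mx_gram rat) E.
have s0 : s%:R != 0 :> rat by rewrite pnatr_eq0 -lt0n.
apply: (@mulmx1_min _ _ _ (sign_mx rat N) (s%:R^-1 *: (sign_mx rat N)^T)).
by rewrite -scalemxAr E scale_scalar_mx mulVf.
Qed.

(** For a square matrix of signs, orthogonality of the rows implies
    orthogonality of the columns. *)
Lemma sign_mx_gram_tr s (N : 'I_s -> 'I_s -> bool) : (0 < s)%N ->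
  orthogonal_rows N -> (sign_mx int N)^T *m sign_mx int N = s%:R%:M.
Proof.
move=> s_gt0 /(sign_mx_gram rat) E.
have s0 : s%:R != 0 :> rat by rewrite pnatr_eq0 -lt0n.
have E' : (sign_mx rat N)^T *m sign_mx rat N = s%:R%:M.
  have : (s%:R^-1 *: (sign_mx rat N)^T) *m sign_mx rat N = 1%:M.
    by apply: mulmx1C; rewrite -scalemxAr E scale_scalar_mx mulVf.
  rewrite -scalemxAl => /(congr1 ( *:%R s%:R)).
  by rewrite scalerA mulfV // scale1r scale_scalar_mx mulr1.
apply/matrixP=> i j; apply: (@intr_inj rat).
have /matrixP/(_ i j) := E'.
rewrite !mxE rmorph_sum /= rmorphMn /= rmorph_nat => <-.
by apply: eq_bigr => l _; rewrite !mxE rmorphM /= !rmorph_sign.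
Qed.

Lemma signed_Kpq_strongly_regular s (N : 'I_s -> 'I_s -> bool) :
  (2 <= s)%N -> orthogonal_rows N -> strongly_regular (signed_Kpq N) s 0 0 0.
Proof.
move=> s2 oN; have s0 := ltnW s2.
apply: adjmx_sqr_strongly_regular; rewrite ?addn_gt0 ?s0 //.
  (* Two vertices of the same part are not adjacent. *)
  move=> [/(_ (lshift s (Ordinal s0)) (lshift s (Ordinal s2)))].
  by rewrite (inj_eq (@lshift_inj _ _)) /= !split_lshift => /(_ isT).
rewrite adjmx_signed_Kpq mulmx_block !mul0mx !mulmx0 !addr0 !add0r.
by rewrite sign_mx_gram // sign_mx_gram_tr // scalar_mx_block.
Qed.

(** A permutation of the indices 0, ..., s - 1 listing the elements of A
    first. *)
Lemma exists_initial_segment s (A : {set 'I_s}) :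
  exists2 g : 'I_s -> 'I_s, injective g & forall j, (g j \in A) = (j < #|A|)%N.
Proof.
pose L := enum A ++ enum (~: A).
have sL : size L = s by rewrite size_cat -!cardE cardsC card_ord.
have uL : uniq L.
  rewrite cat_uniq !enum_uniq andbT /=; apply/hasPn => x.
  by rewrite !mem_enum inE.
exists (fun j => nth j L j) => [i j|j].
  rewrite (set_nth_default j) ?sL // => /eqP.
  by rewrite nth_uniq ?sL // => /eqP/val_inj.
rewrite nth_cat -cardE; case: ltnP => lt.
  by rewrite -mem_enum mem_nth // -cardE.
apply: negbTE; rewrite -in_setC -mem_enum mem_nth // -cardE.
by rewrite ltn_subLR // cardsC card_ord.
Qed.

Lemma sum_half s : ~~ odd s -> \sum_(j < s) sgb (j < s./2)%N = 0.
Proof.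
move=> es; rewrite -(big_mkord xpredT (fun j => sgb (j < s./2)%N)).
rewrite (@big_cat_nat _ _ _ s./2) //=; last by lia.
rewrite (eq_big_nat _ _ (F2 := fun=> -1)) => [|i /andP[_ ->] //].
rewrite [X in _ + X](eq_big_nat _ _ (F2 := fun=> 1)); last first.
  by move=> i /andP[li _]; rewrite ltnNge li.
rewrite !sumr_const_nat subn0 (_ : (s - s./2 = s./2)%N); last by lia.
by rewrite mulNrn addNr.
Qed.

Lemma K2s_orthogonal_rows s : ~~ odd s ->
  orthogonal_rows
    (fun (i : 'I_2) (j : 'I_s) => (i == 0 :> nat)%N && (j < s./2)%N).
Proof.
move=> es i i' ni.
rewrite -[RHS](sum_half es); apply: eq_bigr => j _.
by case: i i' ni => [[|[|//]] ?] [[|[|//]] ?] //= _;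
   rewrite /sgb expr0 ?mulr1 ?mul1r.
Qed.

(** Two orthogonal rows of signs differ at exactly half of the positions. *)
Lemma orthogonal_rows_balanced s (N : 'I_2 -> 'I_s -> bool) :
  orthogonal_rows N ->
  #|[set j | N 0 j (+) N 1 j]| = s./2.
Proof.
move=> /(_ 0 1 isT).
under eq_bigr => j _ do rewrite -sgb_addb.
set A := [set _ | _].
rewrite (bigID (mem A)) /=.
rewrite (eq_bigr (fun=> -1)) => [|j]; last by rewrite inE => ->.
rewrite [X in _ + X](eq_bigr (fun=> 1)) => [|j]; last first.
  by rewrite inE => /negbTE ->.
rewrite sumr_const (eq_bigl [in ~: A]) => [|j]; last by rewrite !inE.
rewrite sumr_const mulNrn !natz; have := cardsC A; rewrite card_ord.
by move: #|A| #|~: A| => a b; lia.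
Qed.

(** * Hadamard matrices and doubling *)

(** A Hadamard matrix whose rows and columns are indexed by a finite type;
    the first condition says that the entries are 1 or -1. *)
Definition hadamard (T : finType) (h : T -> T -> int) : Prop :=
  (forall x y, h x y * h x y = 1) /\
  (forall x x', x != x' -> \sum_y h x y * h x' y = 0).

Definition hadamard_order (m : nat) : Prop :=
  exists (T : finType) (h : T -> T -> int), #|T| = m /\ hadamard h.

Lemma hadamard_order_orthogonal_rows m :
  hadamard_order m -> exists N : 'I_m -> 'I_m -> bool, orthogonal_rows N.
Proof.
move=> [T [h [cT [h1 h0]]]]; subst m.
exists (fun i j => h (enum_val i) (enum_val j) == -1) => i i' ni.
have sgbE x y : sgb (h x y == -1) = h x y.
  have : (h x y == 1) || (h x y == -1) by rewrite -sqrf_eq1 expr2 h1.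
  by case/orP => /eqP ->.
rewrite -[RHS](h0 (enum_val i) (enum_val i')); last first.
  by rewrite (inj_eq enum_val_inj).
rewrite [RHS](reindex (@enum_val T T)) /=; last exact/onW_bij/enum_val_bij.
by apply: eq_bigr => j _; rewrite !sgbE.
Qed.

Lemma sum_pair (I J : finType) (f : I * J -> int) :
  \sum_p f p = \sum_i \sum_j f (i, j).
Proof. by rewrite pair_bigA /=; apply: eq_bigr => -[]. Qed.

Lemma sum_option (T : finType) (f : option T -> int) :
  \sum_x f x = f None + \sum_x f (Some x).
Proof.
rewrite (bigD1 None) //=; congr (_ + _).
rewrite (reindex_omap (@Some T) id) //=; last by case.
by apply: eq_bigl => x; rewrite eqxx.
Qed.

(** Sylvester: the Kronecker product with [[1, 1], [1, -1]]. *)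
Lemma hadamard_order_double m : hadamard_order m -> hadamard_order (2 * m).
Proof.
move=> [T [h [cT [h1 h0]]]].
exists (T * bool)%type, (fun x y => h x.1 y.1 * sgb (x.2 && y.2)).
split; first by rewrite card_prod card_bool cT mulnC.
split=> [x y|[x b] [x' b'] /=]; first by rewrite mulrACA h1 sgb_sqr.
rewrite xpair_eqE => ne; rewrite sum_pair /=.
under eq_bigr => y _ do under eq_bigr => c _ do rewrite mulrACA.
under eq_bigr => y _ do rewrite -mulr_sumr.
rewrite -mulr_suml.
have [ex|nx] := eqVneq x x'; last by rewrite h0 ?mul0r.
by rewrite ex eqxx /= in ne; case: b b' ne => [] [] // _; rewrite big_bool mulr0.
Qed.

Lemma hadamard_order1 : hadamard_order 1.
Proof.
exists unit, (fun _ _ => 1); rewrite card_unit; do !split=> //.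
Qed.

Lemma hadamard_order_pow2 a m : hadamard_order m -> hadamard_order (2 ^ a * m).
Proof.
move=> hm; elim: a => [|a IH]; rewrite ?mul1n // expnS -mulnA.
exact: hadamard_order_double.
Qed.

(** * The quadratic character of a finite field of odd order *)

Section QuadraticCharacter.
Variable F : finFieldType.
Local Notation q := #|F|.
Hypothesis oddq : odd q.
Local Notation m := (q.-1./2).

(** The quadratic character, defined by Euler's criterion: m = (q - 1)/2 and
    x^m = 1 or -1 for every nonzero x. *)
Definition qchar (x : F) : int :=
  if x == 0 then 0 else if x ^+ m == 1 then 1 else -1.

Lemma card_double_half : q = m.*2.+1.
Proof. by have := finNzRing_gt1 F; lia. Qed.

Lemma half_gt0 : (0 < m)%N.
Proof.
have : (1 < q)%N := finNzRing_gt1 F.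
by move: oddq; move: #|F| => k; lia.
Qed.

Lemma expf_half (x : F) : x != 0 -> x ^+ m = 1 \/ x ^+ m = -1.
Proof.
move=> nx; have : (x ^+ m == 1) || (x ^+ m == -1).
  rewrite -sqrf_eq1 -exprM muln2.
  have := expf_card x; rewrite [X in _ ^+ X]card_double_half exprS.
  by move/eqP; rewrite -[X in _ == X]mulr1 (inj_eq (mulfI nx)).
by case/orP=> /eqP; auto.
Qed.

(** In characteristic 2 the order of F would be a power of 2. *)
Lemma two_neq0 : 2%:R != 0 :> F.
Proof.
apply/negP => two0; have F2 : 2%N \in [pchar F] by rewrite inE.
have := card_pprimeChar F2; rewrite /pPrimeCharType => cF.
have := finNzRing_gt1 F; rewrite cF logn_coprime //.
by rewrite coprime2n.
Qed.

Lemma one_neqN1 : 1 != -1 :> F.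
Proof. by rewrite -subr_eq0 opprK -mulr2n two_neq0. Qed.

Lemma qchar0 : qchar 0 = 0. Proof. by rewrite /qchar eqxx. Qed.

Lemma qchar_sqr x : x != 0 -> qchar x * qchar x = 1.
Proof. by move=> /negbTE nx; rewrite /qchar nx; case: ifP. Qed.

Lemma qchar1 : qchar 1 = 1.
Proof. by rewrite /qchar oner_eq0 expr1n eqxx. Qed.

Lemma qcharM x y : qchar (x * y) = qchar x * qchar y.
Proof.
have [->|nx] := eqVneq x 0; first by rewrite mul0r qchar0 mul0r.
have [->|ny] := eqVneq y 0; first by rewrite mulr0 qchar0 mulr0.
rewrite /qchar mulf_eq0 (negbTE nx) (negbTE ny) /= exprMn.
have N1 : (-1 == 1 :> F) = false by rewrite eq_sym (negbTE one_neqN1).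
by case: (expf_half nx) => ->; case: (expf_half ny) => ->;
  rewrite ?mulr1 ?mul1r ?mulrNN ?mul1r ?eqxx ?N1.
Qed.

Lemma qcharN1 : qchar (-1) = sgb (odd m).
Proof.
rewrite /qchar oppr_eq0 oner_eq0 -signr_odd /sgb.
by case: (odd m); rewrite ?eqxx // expr1 eq_sym (negbTE one_neqN1).
Qed.

(** X^m - 1 has at most m roots, fewer than the q - 1 = 2m nonzero elements. *)
Lemma exists_qcharN1 : exists a, qchar a = -1.
Proof.
have [/existsP[a /eqP]|] := boolP [exists a, qchar a == -1]; first by exists a.
move=> /existsPn all1; have m_gt0 := half_gt0.
have := @max_unity_roots F m (enum [set x : F | x != 0]) m_gt0.
rewrite enum_uniq -cardE => /(_ _ isT).
have -> : #|[set x : F | x != 0]| = q.-1.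
  by rewrite -(cardC1 (0 : F)); apply: eq_card => x; rewrite !inE.
suff H : all m.-unity_root (enum [set x : F | x != 0]).
  move=> /(_ H); have := half_gt0; have := card_double_half.
  by move: m => k ->; lia.
apply/allP=> x; rewrite mem_enum inE => nx; apply/unity_rootP.
have := all1 x; rewrite /qchar (negbTE nx).
by case: ifP => [/eqP //|_]; rewrite eqxx.
Qed.

Lemma sum_qchar : \sum_x qchar x = 0.
Proof.
have [a qa] := exists_qcharN1.
have a0 : a != 0 by apply/eqP => a0; move: qa; rewrite a0 qchar0.
have : \sum_x qchar x = - \sum_x qchar x.
  rewrite [LHS](reindex (fun x => a * x)) /=; last first.
    by exists (fun x => a^-1 * x) => x _; rewrite ?mulKf ?mulVKf.
  by under eq_bigr do rewrite qcharM qa mulN1r; rewrite sumrN.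
by move: (\sum_x qchar x) => z; lia.
Qed.

(** For nonzero y one has qchar y * qchar (y + d) = qchar (1 + d / y), and
    1 + d / y runs over all elements except 1. *)
Lemma sum_qchar_shift d : d != 0 -> \sum_y qchar y * qchar (y + d) = -1.
Proof.
move=> d0; rewrite (bigD1 0) //= qchar0 mul0r add0r.
transitivity (\sum_(z | z != 1) qchar z); last first.
  have := sum_qchar; rewrite (bigD1 1) //= qchar1.
  by move: (\sum_(_ | _) _) => z; lia.
rewrite [RHS](reindex_onto (fun y => 1 + d / y) (fun z => d / (z - 1))) /=;
  last first.
  by move=> z nz; rewrite invf_div mulrC divfK // addrC subrK.
apply: eq_big => y; last first.
  move=> ny; have -> : y + d = y * (1 + d / y) by field.
  by rewrite qcharM mulrA qchar_sqr // mul1r.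
have E : 1 + d / y - 1 = d / y by ring.
rewrite E -[1 + d / y == 1]subr_eq0 E mulf_eq0 (negbTE d0) invr_eq0 /=.
(* The inverse of 0 is 0, so y = 0 gives 1 + d / y = 1, which is excluded. *)
have [->|ny] := eqVneq y 0; first by [].
by rewrite invf_div mulrC divfK // eqxx.
Qed.

Lemma sum_qchar_pair x x' : x != x' ->
  \sum_y qchar (y - x) * qchar (y - x') = -1.
Proof.
move=> nx; rewrite -(@sum_qchar_shift (x - x')) ?subr_eq0 //.
rewrite [LHS](reindex (fun y => y + x)) /=; last first.
  by exists (fun y => y - x) => y _; rewrite ?addrK ?subrK.
by apply: eq_bigr => y _; rewrite addrK addrA.
Qed.

Lemma sum_qchar_sub x : \sum_y qchar (y - x) = 0.
Proof.
rewrite -[RHS]sum_qchar [LHS](reindex (fun y => y + x)) /=; last first.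
  by exists (fun y => y - x) => y _; rewrite ?addrK ?subrK.
by apply: eq_bigr => y _; rewrite addrK.
Qed.

Lemma qchar_subC x y : qchar (x - y) = sgb (odd m) * qchar (y - x).
Proof. by rewrite -qcharN1 -qcharM mulN1r opprB. Qed.
End QuadraticCharacter.

(** * The constructions of Paley and Scarpis *)

(** What remains of a Hadamard matrix with first row and first column
    constantly 1 once these are removed. *)
Definition hadamard_core (T : finType) (C : T -> T -> int) : Prop :=
  [/\ forall x y, C x y * C x y = 1, forall x, \sum_y C x y = -1
    & forall x x', x != x' -> \sum_y C x y * C x' y = -1].

Lemma hadamard_core_self (T : finType) (C : T -> T -> int) x :
  hadamard_core C -> \sum_y C x y * C x y = #|T|%:R.
Proof. by case=> C1 _ _; under eq_bigr do rewrite C1; rewrite sumr_const. Qed.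

Lemma hadamard_order_core (T : finType) (C : T -> T -> int) :
  hadamard_core C -> hadamard_order (#|T| + 1).
Proof.
move=> [C1 Cs CC]; exists (option T), (fun x y =>
  match x, y with Some x, Some y => C x y | _, _ => 1 end).
rewrite card_option addn1; split=> //; split=> [[x|] [y|] //|].
move=> [x|] [x'|] nx //; rewrite sum_option mulr1.
- by rewrite CC ?subrr.
- by under eq_bigr do rewrite mulr1; rewrite Cs subrr.
- by under eq_bigr do rewrite mul1r; rewrite Cs subrr.
Qed.

Lemma sum_kron (T : finType) (x : T) (f : T -> int) :
  \sum_y (x == y)%:R * f y = f x.
Proof.
rewrite (bigD1 x) //= eqxx mul1r big1 ?addr0 // => y /negbTE ny.
by rewrite eq_sym ny mul0r.
Qed.

(** The matrix of the quadratic character of y - x, with -1 on the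
    diagonal. *)
Definition paley_core (F : finFieldType) (x y : F) : int :=
  qchar (y - x) - (x == y)%:R.

Lemma paley_coreP (F : finFieldType) :
  (#|F| %% 4 = 3)%N -> hadamard_core (@paley_core F).
Proof.
move=> cF; have oF : odd #|F| by lia.
have om : odd (#|F|.-1./2) by lia.
rewrite /paley_core; split=> [x y|x|x x' nx].
- have [->|nx] := eqVneq x y; first by rewrite subrr qchar0.
  by rewrite subr0 qchar_sqr // subr_eq0 eq_sym.
- rewrite sumrB sum_qchar_sub // sub0r.
  by under eq_bigr do rewrite -[_%:R]mulr1; rewrite sum_kron.
(* The two cross terms cancel because qchar is odd when q = 3 mod 4. *)
transitivity (\sum_y qchar (y - x) * qchar (y - x')
   - \sum_y (x == y)%:R * qchar (y - x') - \sum_y (x' == y)%:R * qchar (y - x)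
   + \sum_y (x == y)%:R * (x' == y)%:R :> int).
  by rewrite -!sumrB -big_split /=; apply: eq_bigr => y _; ring.
rewrite sum_qchar_pair // !sum_kron qchar_subC // om eq_sym (negbTE nx) /sgb.
by rewrite expr1 addr0 mulN1r opprK addrK.
Qed.

Lemma hadamard_order_paley1 (F : finFieldType) :
  (#|F| %% 4 = 3)%N -> hadamard_order (#|F| + 1).
Proof. by move=> cF; apply: hadamard_order_core (paley_coreP cF). Qed.

(** Scarpis.  The row (a, b) carries, in the x-th block of columns, the row
    of C with index a x + b, and in an additional block the row a of C.  Two
    lines of distinct slopes meet in one point and two parallel ones in none;
    as distinct rows of C have inner product -1 and equal ones q, the inner
    products cancel.  The q rows indexed by (None, b) are constant on the
    blocks, with values given by the row b of the bordered matrix. *)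
Lemma hadamard_order_scarpis (F : finFieldType) (C : F -> F -> int) :
  hadamard_core C -> hadamard_order (#|F| * (#|F| + 1)).
Proof.
move=> coreC; have [C1 Cs CC] := coreC.
pose e b x : int := if x is Some x then C b x else 1.
exists (option F * F)%type, (fun r c =>
  match r.1, c.1 with
  | Some a, Some x => C (a * x + r.2) c.2
  | Some a, None => C a c.2
  | None, x => e r.2 x
  end).
rewrite card_prod card_option addn1 mulnC; split=> //; split.
  by move=> [[a|] b] [[x|] y] //=; rewrite C1.
have inner x x' : \sum_y C x y * C x' y = #|F|.+1%:R * (x == x')%:R - 1.
  have [<-|nx] := eqVneq x x'; last by rewrite CC // mulr0 sub0r.
  by rewrite hadamard_core_self // mulr1 -addn1 natrD addrK.
move=> [[a|] b] [[a'|] b'] nx; rewrite sum_pair /= sum_option /=.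
- under [X in _ + X]eq_bigr do rewrite inner.
  rewrite inner sumrB -mulr_sumr sumr_const.
  have [ea|na] := eqVneq a a'.
    rewrite big1 ?mulr0; first by rewrite mulr1; move: #|F|=> k; lia.
    move=> x _; rewrite ea (inj_eq (addrI _)).
    apply/eqP; rewrite pnatr_eq0 eqb0.
    by apply: contra nx => /eqP ->; rewrite ea.
  (* the abscissa of the intersection point *)
  rewrite (bigD1 ((b' - b) / (a - a'))) //= big1 => [|x].
    rewrite (_ : (_ == _) = true); last first.
      by apply/eqP; have : a - a' != 0 by [rewrite subr_eq0]; move=> ?; field.
    by move: #|F|=> k; lia.
  move=> nxx; apply/eqP; rewrite pnatr_eq0 eqb0; apply: contra nxx => /eqP E.
  have na' : a - a' != 0 by rewrite subr_eq0.
  apply/eqP/(mulIf na'); rewrite divfK //.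
  have -> : b' = a * x + b - a' * x by rewrite E; ring.
  ring.
- rewrite /e; under eq_bigr do rewrite mulr1.
  rewrite Cs; under eq_bigr do rewrite -mulr_suml Cs mulN1r.
  by rewrite sumrN Cs opprK subrr.
- rewrite /e; under eq_bigr do rewrite mul1r.
  rewrite Cs; under eq_bigr do rewrite -mulr_sumr Cs mulrN1.
  by rewrite sumrN Cs opprK subrr.
- rewrite /e /= !sumr_const.
  under eq_bigr do rewrite sumr_const.
  by rewrite sumrMnl CC ?mul1r ?mulNrn ?subrr.
Qed.

(** With S the symmetric conference matrix of order q + 1, this is the matrix
    S (x) [[1, 1], [1, -1]] + I (x) [[1, -1], [-1, -1]]. *)
Lemma hadamard_order_paley2 (F : finFieldType) :
  (#|F| %% 4 = 1)%N -> hadamard_order (2 * (#|F| + 1)).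
Proof.
move=> cF; have oF : odd #|F| by lia.
have em : odd (#|F|.-1./2) = false by lia.
pose S (x y : option F) : int :=
  match x, y with
  | None, None => 0 | Some x, Some y => qchar (y - x) | _, _ => 1
  end.
have Ssym x y : S x y = S y x.
  by case: x y => [x|] [y|] //=; rewrite qchar_subC // em mul1r.
have Sdiag x : S x x = 0 by case: x => [x|] //=; rewrite subrr qchar0.
have Ssqr x y : x != y -> S x y * S x y = 1.
  case: x y => [x|] [y|] //= nx; rewrite qchar_sqr // subr_eq0 eq_sym.
  by apply: contra nx => /eqP ->.
have SS x x' : x != x' -> \sum_z S x z * S x' z = 0.
  move=> nx; rewrite sum_option; case: x x' nx => [x|] [x'|] nx //=.
  - rewrite sum_qchar_pair //; apply: contra nx => /eqP -> //.
  - by under eq_bigr do rewrite mulr1; rewrite sum_qchar_sub.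
  - by under eq_bigr do rewrite mul1r; rewrite sum_qchar_sub.
pose K (b c : bool) : int := sgb (b && c).
pose L (b c : bool) : int := - sgb (~~ b && ~~ c).
exists (option F * bool)%type, (fun x y =>
  S x.1 y.1 * K x.2 y.2 + (x.1 == y.1)%:R * L x.2 y.2).
split; first by rewrite card_prod card_option card_bool addn1 mulnC.
split=> [[x b] [y c] /=|[x b] [x' b'] nx].
  have [->|nx] := eqVneq x y.
    by rewrite Sdiag mul0r add0r mul1r; case: b c => [] [].
  by rewrite mul0r addr0 mulrACA Ssqr // sgb_sqr.
rewrite sum_pair /=.
transitivity (\sum_z S x z * S x' z * (\sum_c K b c * K b' c)
  + \sum_z (x == z)%:R * (S x' z * (\sum_c L b c * K b' c))
  + \sum_z (x' == z)%:R * (S x z * (\sum_c K b c * L b' c))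
  + \sum_z (x == z)%:R * ((x' == z)%:R * \sum_c L b c * L b' c)).
  rewrite -!big_split /=; apply: eq_bigr => z _.
  by rewrite !big_bool /=; ring.
rewrite -mulr_suml !sum_kron (Ssym x' x) -addrA -addrA [X in _ + X]addrA -mulrDr.
have -> : \sum_c L b c * K b' c + \sum_c K b c * L b' c = 0.
  by rewrite !big_bool; case: b b' {nx} => [] [].
rewrite mulr0 add0r.
have [ex|nxx] := eqVneq x x'.
  rewrite -ex mul1r.
  have nb : b != b' by apply: contra nx => /eqP ->; rewrite ex.
  have -> : \sum_c K b c * K b' c = 0.
    by rewrite big_bool; case: b b' nb {nx} => [] [].
  have -> : \sum_c L b c * L b' c = 0.
    by rewrite big_bool; case: b b' nb {nx} => [] [].
  by rewrite mulr0.
by rewrite SS // !mul0r.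
Qed.

(** * Circulant matrices *)

Section Circulant.
Variable n : nat.
Local Notation t := n.+1.
Local Notation Mt := 'M[int]_t.

(** The cyclic shift i |-> i + 1.  The index type 'I_n.+1 carries the additive
    group of integers modulo n + 1, whose generator is inZp 1. *)
Definition shift_mx : Mt := \matrix_(i, j) (j == i + inZp 1)%:R.
(** The reversal i |-> - i. *)
Definition rev_mx : Mt := \matrix_(i, j) (i + j == 0)%:R.

Lemma shift_mxX k i j : (shift_mx ^+ k) i j = (j == i + inZp 1 *+ k)%:R.
Proof.
elim: k i j => [|k IH] i j; first by rewrite expr0 mulr0n addr0 mxE eq_sym.
rewrite exprS mxE (bigD1 (i + inZp 1)) //= big1 => [|l nl]; last first.
  by rewrite mxE (negbTE nl) mul0r.
by rewrite addr0 mxE eqxx mul1r IH mulrS addrA.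
Qed.

Lemma inZp1_mulrn k : (inZp 1 : 'I_t) *+ k = inZp k.
Proof. by rewrite Zp_mulrn; apply/val_inj; rewrite /= modnMml mul1n. Qed.

Lemma shift_mx_period : shift_mx ^+ t = 1.
Proof.
apply/matrixP=> i j; rewrite shift_mxX inZp1_mulrn !mxE eq_sym.
by congr ((_ == _)%:R); apply/val_inj; rewrite /= modnn addn0 modn_small.
Qed.

(** The circulant matrix of a polynomial.  When the degree of p is at most n,
    its first row lists the coefficients of p. *)
Definition circ (p : {poly int}) : Mt := horner_mx shift_mx p.
(** A polynomial whose circulant matrix is the transpose of that of p: the
    inverse of the shift is its n-th power. *)
Definition bar (p : {poly int}) : {poly int} := p \Po 'X^n.

Lemma circE (p : {poly int}) i j :
  (size p <= t)%N -> circ p i j = p`_(nat_of_ord (j - i)%R).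
Proof.
move=> sp; have [d ->] : exists d, j = i + d.
  by exists (j - i); rewrite addrC subrK.
rewrite [i + d - i]addrAC subrr add0r /circ -[p in LHS](coefK p) poly_def.
rewrite linear_sum summxE.
under eq_bigr => k _ do rewrite linearZ /= rmorphXn /= horner_mx_X mxE
  shift_mxX inZp1_mulrn (inj_eq (addrI i)).
have Ed (k : 'I_(size p)) : (d == inZp k) = (k == d :> nat).
  rewrite -val_eqE /= modn_small; first by rewrite eq_sym.
  by apply: leq_trans sp.
have [lt|ge] := ltnP d (size p).
  rewrite (bigD1 (Ordinal lt) isT) big1 => [|k /andP[_ nk]].
    by rewrite [LHS]addr0 Ed eqxx mulr1.
  by rewrite Ed (_ : (k == d :> nat) = false) ?mulr0 //; apply: negbTE.
rewrite nth_default // big1 // => k _.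
by rewrite Ed ltn_eqF ?mulr0 // (leq_trans (ltn_ord k)).
Qed.

Lemma circM p q : circ (p * q) = circ p *m circ q.
Proof. by rewrite /circ rmorphM. Qed.

Lemma tr_shift_mx : shift_mx^T = shift_mx ^+ n.
Proof.
apply/matrixP=> i j; rewrite mxE shift_mxX mxE.
have u0 : (inZp 1 : 'I_t) *+ n.+1 = 0.
  by rewrite inZp1_mulrn; apply/val_inj; rewrite /= modnn.
by congr (_%:R); congr nat_of_bool; apply/eqP/eqP => ->;
  rewrite -addrA -?mulrS -?mulrSr u0 addr0.
Qed.

Lemma circD p q : circ (p + q) = circ p + circ q.
Proof. by rewrite /circ rmorphD. Qed.

Lemma circC c : circ c%:P = c%:M.
Proof. exact: horner_mx_C. Qed.

Lemma circX : circ 'X = shift_mx.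
Proof. exact: horner_mx_X. Qed.

Lemma circXn k : circ 'X^k = shift_mx ^+ k.
Proof. by rewrite /circ rmorphXn /= horner_mx_X. Qed.

Lemma circ_bar p : circ (bar p) = (circ p)^T.
Proof.
elim/poly_ind: p => [|p c IH].
  by rewrite /bar comp_poly0 /circ rmorph0 trmx0.
rewrite /bar comp_polyD comp_polyM comp_polyX comp_polyC -/(bar p).
rewrite !circD !circM !circC circX circXn -tr_shift_mx IH.
rewrite [RHS]linearD /= tr_scalar_mx; congr (_ + _).
by rewrite -trmx_mul -circX -!circM mulrC.
Qed.

Lemma rev_mxK : rev_mx *m rev_mx = 1%:M.
Proof.
apply/matrixP=> i j; rewrite mxE (bigD1 (- i)) //= big1 => [|l nl].
  rewrite !mxE subrr eqxx mul1r addr0; congr (_%:R).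
  by rewrite addrC subr_eq0 eq_sym.
by rewrite !mxE [i + l]addrC addr_eq0 (negbTE nl) mul0r.
Qed.

Lemma rev_mx_tr : rev_mx^T = rev_mx.
Proof. by apply/matrixP=> i j; rewrite !mxE addrC. Qed.

Lemma mul_rev_mx (A : Mt) i j : (A *m rev_mx) i j = A i (- j).
Proof.
rewrite mxE (bigD1 (- j)) //= big1 => [|l nl].
  by rewrite mxE addNr eqxx mulr1 addr0.
rewrite mxE (_ : _ == _ = false) ?mulr0 // addrC addr_eq0.
by apply: contraNF nl => /eqP ->; rewrite opprK.
Qed.

Lemma rev_mx_circ p : rev_mx *m circ p = circ (bar p) *m rev_mx.
Proof.
elim/poly_ind: p => [|p c IH].
  by rewrite /bar comp_poly0 /circ rmorph0 mul0mx mulmx0.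
rewrite /bar comp_polyD comp_polyM comp_polyX comp_polyC -/(bar p).
rewrite !circD !circM !circC circX circXn -tr_shift_mx.
rewrite mulmxDr mulmxDl scalar_mxC; congr (_ + _).
rewrite mulmxA IH -!mulmxA; congr (_ *m _).
apply/matrixP=> i j; rewrite mul_rev_mx [LHS]mxE (bigD1 (- i)) //= big1 => [|l nl].
  by rewrite !mxE subrr eqxx mul1r addr0 ![- _ + _]addrC -!subr_eq !opprK addrC.
by rewrite mxE addrC addr_eq0 (negbTE nl) mul0r.
Qed.
End Circulant.

(** * The Goethals-Seidel array *)

(** All entries are 1 or -1. *)
Definition pm1_mx m (M : 'M[int]_m) : Prop := forall i j, M i j * M i j = 1.

(** A block matrix is a Hadamard matrix when its blocks have entries 1 and
    -1, distinct block rows are orthogonal, and each block row has a scalar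
    Gram matrix. *)
Lemma hadamard_order_blocks (K : finType) m (M : K -> K -> 'M[int]_m) (c : int) :
  (forall a b, pm1_mx (M a b)) ->
  (forall a, \sum_b M a b *m (M a b)^T = c%:M) ->
  (forall a a', a != a' -> \sum_b M a b *m (M a' b)^T = 0) ->
  hadamard_order (#|K| * m).
Proof.
move=> M1 Md M0.
exists (K * 'I_m)%type, (fun x y => M x.1 y.1 x.2 y.2).
split; first by rewrite card_prod card_ord.
split=> [x y|[a i] [a' i'] nx]; first exact: M1.
rewrite sum_pair /=.
have -> : \sum_b \sum_j M a b i j * M a' b i' j =
          (\sum_b M a b *m (M a' b)^T) i i'.
  rewrite summxE; apply: eq_bigr => b _; rewrite mxE.
  by apply: eq_bigr => j _; rewrite mxE.
have [ea|/M0 ->] := eqVneq a a'; last by rewrite mxE.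
rewrite -ea Md mxE (_ : (i == i') = false) //.
by apply: contra_neqF nx => /eqP ->; rewrite ea.
Qed.

Section GoethalsSeidel.
Variable n : nat.
Local Notation t := n.+1.
Variables (a b c d : {poly int}) (k : int).
Local Notation circ := (@circ n).
Local Notation bar := (bar n).
Local Notation R := (@rev_mx n).
Hypothesis pm1a : pm1_mx (circ a).
Hypothesis pm1b : pm1_mx (circ b).
Hypothesis pm1c : pm1_mx (circ c).
Hypothesis pm1d : pm1_mx (circ d).
Hypothesis norm : circ (a * bar a + b * bar b + c * bar c + d * bar d) = k%:M.

(** The Goethals-Seidel array, with block indices in bool * bool:
      [   a      b R     c R     d R  ]
      [ - b R     a     d' R   - c' R ]
      [ - c R  - d' R     a      b' R ]
      [ - d R    c' R  - b' R     a   ]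
    where ' denotes the transpose. *)
Definition gs_array (x y : bool * bool) : 'M[int]_t :=
  match x, y with
  | (false, false), (false, false) => circ a
  | (false, false), (false, true) => circ b *m R
  | (false, false), (true, false) => circ c *m R
  | (false, false), (true, true) => circ d *m R
  | (false, true), (false, false) => - (circ b *m R)
  | (false, true), (false, true) => circ a
  | (false, true), (true, false) => (circ d)^T *m R
  | (false, true), (true, true) => - ((circ c)^T *m R)
  | (true, false), (false, false) => - (circ c *m R)
  | (true, false), (false, true) => - ((circ d)^T *m R)
  | (true, false), (true, false) => circ a
  | (true, false), (true, true) => (circ b)^T *m R
  | (true, true), (false, false) => - (circ d *m R)
  | (true, true), (false, true) => (circ c)^T *m R
  | (true, true), (true, false) => - ((circ b)^T *m R)
  | (true, true), (true, true) => circ a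
  end.

Lemma circ_comm p q : circ p *m circ q = circ q *m circ p.
Proof. by rewrite -!circM mulrC. Qed.

Lemma circ_comm_tr p q : circ p *m (circ q)^T = (circ q)^T *m circ p.
Proof. by rewrite -circ_bar -!circM mulrC. Qed.

Lemma circ_comm_tr2 p q : (circ p)^T *m (circ q)^T = (circ q)^T *m (circ p)^T.
Proof. by rewrite -!circ_bar -!circM mulrC. Qed.

Lemma rev_circ p : R *m circ p = (circ p)^T *m R.
Proof. by rewrite rev_mx_circ circ_bar. Qed.

Lemma rev_circ_tr p : R *m (circ p)^T = circ p *m R.
Proof. by rewrite -circ_bar rev_mx_circ !circ_bar trmxK. Qed.

Lemma mulmx_revK (A B : 'M[int]_t) : (A *m R) *m (R *m B) = A *m B.
Proof. by rewrite -mulmxA [R *m _]mulmxA rev_mxK mul1mx. Qed.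

Lemma sum_bool2 (f : bool * bool -> 'M[int]_t) :
  \sum_x f x =
  f (true, true) + f (true, false) + (f (false, true) + f (false, false)).
Proof.
rewrite (eq_bigr (fun x => f (x.1, x.2))) => [|[]//].
by rewrite -(pair_bigA _ (fun x y => f (x, y))) /= !big_bool.
Qed.

(** Circulants commute and R conjugates each of them to its transpose, so the
    terms of the product of two distinct block rows cancel in pairs. *)
Lemma goethals_seidel : hadamard_order (4 * t).
Proof.
have -> : (4 * t = #|{: bool * bool}| * t)%N by rewrite card_prod card_bool.
have pmT A : pm1_mx A -> pm1_mx (A^T : 'M[int]_t) by move=> A1 i j; rewrite !mxE.
have pmR A : pm1_mx A -> pm1_mx (A *m R : 'M[int]_t).
  by move=> A1 i j; rewrite !mul_rev_mx.
have trN (A : 'M[int]_t) : (- A)^T = - A^T by exact: linearN.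
have pmN A : pm1_mx A -> pm1_mx (- A : 'M[int]_t).
  by move=> A1 i j; rewrite !mxE mulrNN.
apply: (@hadamard_order_blocks _ _ gs_array k).
- by move=> [[] []] [[] []] /=; auto.
- move=> x; rewrite -norm sum_bool2.
  by move: x => [[] []] /=;
    rewrite ?trN ?trmx_mul ?trmxK ?rev_mx_tr ?mulmxN ?mulNmx ?opprK
      ?mulmx_revK -!circ_bar -!circM -!circD; congr circ; ring.
have H p : circ a *m (R *m circ p) = (circ p)^T *m R *m (circ a)^T.
  by rewrite -mulmxA rev_circ rev_circ_tr !mulmxA circ_comm_tr.
have H' p : circ a *m (R *m (circ p)^T) = circ p *m R *m (circ a)^T.
  by rewrite -mulmxA !rev_circ_tr !mulmxA circ_comm.
move=> x y nxy; rewrite sum_bool2.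
move: x y nxy => [[] []] [[] []] //= _;
  rewrite ?trN ?trmx_mul ?trmxK ?rev_mx_tr ?mulmxN ?mulNmx ?opprK
     ?mulmx_revK ?H ?H' ?circ_comm_tr ?(circ_comm c b) ?(circ_comm d b)
     ?(circ_comm d c) ?(circ_comm_tr2 c b) ?(circ_comm_tr2 d b)
     ?(circ_comm_tr2 d c);
  solve [ by rewrite ?subrr ?addNr addr0
        | by rewrite addrACA ?subrr ?addNr addr0
        | by rewrite [X in _ + X]addrC addrACA ?subrr ?addNr addr0 ].
Qed.
End GoethalsSeidel.

(** * Golay pairs and the orders 4(2g+1) with g a power of two *)

(** Golay pairs of length 2^k, as polynomials with coefficients 1 and -1. *)
Fixpoint golay (k : nat) : {poly int} * {poly int} :=
  if k is k'.+1 then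
    let: (p, q) := golay k' in
    (p + 'X^(2 ^ k') * q, p - 'X^(2 ^ k') * q)
  else (1, 1).

Lemma golay_coef k i :
  ((golay k).1`_i * (golay k).1`_i = (i < 2 ^ k)%N%:R) /\
  ((golay k).2`_i * (golay k).2`_i = (i < 2 ^ k)%N%:R).
Proof.
elim: k i => [|k IH] i /=; first by rewrite coef1 expn0; case: i => [|[|i]].
case: (golay k) IH => p q /= IH.
have [ge|lt] := leqP (2 ^ k) i.
  have p0 : p`_i = 0.
    by apply/eqP; rewrite -sqrf_eq0 expr2 (IH i).1 ltnNge ge.
  rewrite !(coefD, coefN, coefXnM) p0 add0r sub0r mulrNN ltnNge ge /=.
  by rewrite (IH _).2 expnS ltn_subLR // addnn mul2n.
rewrite !(coefD, coefN, coefXnM) lt oppr0 addr0 (IH i).1 lt.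
by rewrite (leq_trans lt) // leq_exp2l.
Qed.

Lemma barD m p q : bar m (p + q) = bar m p + bar m q.
Proof. exact: comp_polyD. Qed.
Lemma barN m p : bar m (- p) = - bar m p.
Proof. by rewrite /bar raddfN. Qed.
Lemma barM m p q : bar m (p * q) = bar m p * bar m q.
Proof. exact: comp_polyM. Qed.
Lemma barXn m k : bar m 'X^k = 'X^(m * k).
Proof. by rewrite /bar comp_Xn_poly exprM. Qed.

Lemma circ_period m k : circ m 'X^(m.+1 * k) = 1%:M.
Proof. by rewrite circXn exprM shift_mx_period expr1n. Qed.

(** The defining property of a Golay pair, in the ring of circulants. *)
Lemma golay_norm m k :
  circ m ((golay k).1 * bar m (golay k).1 + (golay k).2 * bar m (golay k).2)
  = (2 ^ k.+1)%N%:R%:M.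
Proof.
elim: k => [|k] /=.
  by rewrite /bar comp_polyC mulr1 -polyCD circC.
case: (golay k) => p q /= IH.
rewrite !(barD, barN, barM) barXn.
set p' := bar m p in IH *; set q' := bar m q in IH *.
have -> : (p + 'X^(2 ^ k) * q) * (p' + 'X^(m * 2 ^ k) * q')
  + (p - 'X^(2 ^ k) * q) * (p' - 'X^(m * 2 ^ k) * q')
  = 2%:P * (p * p' + 'X^(m.+1 * 2 ^ k) * (q * q')).
  rewrite mulSn exprD (_ : 2%:P = 2); first by ring.
  by rewrite -[2]/(2%:R) polyC_natr.
rewrite circM circC circD [circ m ('X^_ * _)]circM circ_period mul1mx -circD IH.
by rewrite -scalar_mxM -natrM -expnS.
Qed.

Section Turyn.
Variable h : nat.
Local Notation g := (2 ^ h)%N.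
Local Notation n := (2 * g)%N.
Local Notation P := (golay h).1.
Local Notation Q := (golay h).2.

(** The sequence 1 and the Golay sequences P and Q are placed at the positions
    0, then 1, ..., g, and g + 1, ..., 2g, so that exactly one of the three is
    nonzero at each position. *)
Definition turyn_P : {poly int} := 'X^1 * P.
Definition turyn_Q : {poly int} := 'X^(g.+1) * Q.

Lemma turyn_coef (i : nat) : (i < n.+1)%N ->
  let one : {poly int} := 1 in
  [/\ one`_i * one`_i + turyn_P`_i * turyn_P`_i + turyn_Q`_i * turyn_Q`_i = 1,
      one`_i * turyn_P`_i = 0, one`_i * turyn_Q`_i = 0
    & turyn_P`_i * turyn_Q`_i = 0].
Proof.
move=> lt one; rewrite /turyn_P /turyn_Q coef1 !coefXnM.
case: i lt => [|i] lt /=; first by split.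
rewrite !mul0r !add0r !subSS subn0 ltnS; split=> //.
  have [lig|ge] := ltnP i g; first by rewrite mulr0 addr0 (golay_coef h i).1 lig.
  have lt' : (i - g < g)%N by lia.
  by rewrite (golay_coef h i).1 ltnNge ge add0r (golay_coef h _).2 lt'.
have [lig|ge] := ltnP i g; first by rewrite mulr0.
have -> : P`_i = 0; last by rewrite mul0r.
by apply/eqP; rewrite -sqrf_eq0 expr2 (golay_coef h i).1 ltnNge ge.
Qed.

(** The four circulants x, y, z, w are the combinations of 1, turyn_P and
    turyn_Q with the signs +++, ++-, +-+ and -++.  Since the columns of this
    table of signs are orthogonal, x x' + y y' + z z' + w w' is
    4 (1 + P P' + Q Q') = 4 (1 + 2g). *)
Lemma hadamard_order_turyn : hadamard_order (4 * (2 * 2 ^ h + 1)).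
Proof.
rewrite addn1.
have size_P : (size turyn_P <= n.+1)%N.
  apply/leq_sizeP => i lei; rewrite /turyn_P /turyn_Q coefXnM; case: ifP => // _.
  apply/eqP; rewrite -sqrf_eq0 expr2 (golay_coef h _).1.
  by rewrite (_ : (_ < _)%N = false) //; have := expn_gt0 2 h; lia.
have size_Q : (size turyn_Q <= n.+1)%N.
  apply/leq_sizeP => i lei; rewrite /turyn_P /turyn_Q coefXnM; case: ifP => // _.
  apply/eqP; rewrite -sqrf_eq0 expr2 (golay_coef h _).2.
  by rewrite (_ : (_ < _)%N = false) //; have := expn_gt0 2 h; lia.
have pm1 (e1 e2 e3 : bool) : pm1_mx
    (circ n ((-1) ^+ e1 * 1 + (-1) ^+ e2 * turyn_P + (-1) ^+ e3 * turyn_Q)).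
  move=> i j; rewrite !circE.
    set k := nat_of_ord _; have [/= E1 E2 E3 E4] := turyn_coef (ltn_ord (j - i)).
    rewrite -/k in E1 E2 E3 E4.
    have sgnM (e : bool) (p : {poly int}) :
        ((-1) ^+ e * p)`_k = (-1) ^+ e * p`_k.
      by case: e; rewrite ?expr1 ?expr0 ?mul1r // !mulN1r coefN.
    rewrite !coefD !sgnM; move: E1 E2 E3 E4.
    move: ((1 : {poly int})`_k) (turyn_P`_k) (turyn_Q`_k) => u v r E1 E2 E3 E4.
    transitivity (u * u + v * v + r * r + 2 * (-1) ^+ e1 * (-1) ^+ e2 * (u * v)
      + 2 * (-1) ^+ e1 * (-1) ^+ e3 * (u * r)
      + 2 * (-1) ^+ e2 * (-1) ^+ e3 * (v * r)).
      by case: e1; case: e2; case: e3; rewrite ?expr1 ?expr0; ring.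
    by rewrite E1 E2 E3 E4 !mulr0 !addr0.
  have sz (e : bool) (p : {poly int}) :
      (size ((-1) ^+ e * p)%R <= n.+1)%N = (size p <= n.+1)%N.
    by case: e; rewrite ?expr1 ?expr0 ?mul1r // mulN1r size_polyN.
  apply: leq_trans (size_polyD _ _) _; rewrite geq_max sz size_Q andbT.
  apply: leq_trans (size_polyD _ _) _.
  by rewrite geq_max !sz size_P size_poly1.
pose x : {poly int} := 1 + turyn_P + turyn_Q.
pose y : {poly int} := 1 + turyn_P - turyn_Q.
pose z : {poly int} := 1 - turyn_P + turyn_Q.
pose w : {poly int} := - 1 + turyn_P + turyn_Q.
apply: (@goethals_seidel n x y z w (4 * n.+1)%N%:R).
- by have := pm1 false false false; rewrite !expr0 !mul1r.
- by have := pm1 false false true; rewrite !expr0 expr1 !mul1r mulN1r.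
- by have := pm1 false true false; rewrite !expr0 expr1 !mul1r mulN1r.
- by have := pm1 true false false; rewrite !expr0 expr1 !mul1r mulN1r.
rewrite /x /y /z /w !(barD, barN) (_ : bar n 1 = 1); last exact: comp_polyC.
set t2 := bar n turyn_P; set t3 := bar n turyn_Q.
transitivity (circ n (4%:P * (1 + turyn_P * t2 + turyn_Q * t3))).
  congr circ; rewrite (_ : 4%:P = 4); first by ring.
  by rewrite -[4]/(4%:R) polyC_natr.
have -> : turyn_P * t2 = 'X^(n.+1 * 1) * (P * bar n P).
  by rewrite /t2 /turyn_P barM barXn (mulSn n) exprD; ring.
have -> : turyn_Q * t3 = 'X^(n.+1 * g.+1) * (Q * bar n Q).
  by rewrite /t3 /turyn_Q barM barXn (mulSn n) exprD; ring.
rewrite circM circC -addrA circD [circ n ('X^_ * _ + _)]circD.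
rewrite [circ n ('X^_ * _)]circM [X in _ + (_ + X)]circM !circ_period !mul1mx.
rewrite -circD golay_norm circC -raddfD -scalar_mxM.
by congr (_%:M); rewrite natrM expnS addrC natr1.
Qed.
End Turyn.

(** * Orders of Hadamard matrices and the theorem *)

Lemma prime_power_finField q :
  prime_power q -> exists F : finFieldType, #|F| = q.
Proof.
move=> [p [k [pp k0 ->]]].
by have [F _ cF] := pPrimePowerField pp k0; exists F.
Qed.

Lemma in_NH_hadamard_order m : in_NH m -> hadamard_order m.
Proof.
case=> [a _ ->|a h r a2 h1 pr ->|a r a2 pr r3 ->|r pp r3 ->|r pp r1 ->].
- rewrite -[X in hadamard_order X]muln1.
  exact/hadamard_order_pow2/hadamard_order1.
- (* For r = 2, 2^h + 1 = 2 * 2^(h - 1) + 1 is of Turyn's form. *)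
  have [er|od] := boolP (r == 2%N).
    rewrite (eqP er) (_ : (2 ^ a = 2 ^ (a - 2) * 4)%N); last first.
      by rewrite -(expnD 2 _ 2) subnK.
    rewrite -mulnA; apply: hadamard_order_pow2.
    case: h h1 => // h _; rewrite expnS; exact: hadamard_order_turyn.
  have [F _ cF] := pPrimePowerField pr h1.
  have oq : odd (r ^ h)%N.
    by rewrite oddX; case: (even_prime pr) od => [->//|-> _]; rewrite orbT.
  have [q1|q3] : ((r ^ h) %% 4 = 1 \/ (r ^ h) %% 4 = 3)%N by lia.
    rewrite (_ : (2 ^ a = 2 ^ (a - 1) * 2)%N); last first.
      by rewrite -(expnD 2 _ 1) subnK // ltnW.
    rewrite -mulnA; apply: hadamard_order_pow2.
    by rewrite -cF; apply: hadamard_order_paley2; rewrite cF.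
  apply: hadamard_order_pow2; rewrite -cF.
  by apply: hadamard_order_paley1; rewrite cF.
- have [F _ cF] := pPrimePowerField pr (isT : (0 < 1)%N); rewrite expn1 in cF.
  apply: hadamard_order_pow2; rewrite -cF.
  by apply: hadamard_order_scarpis (paley_coreP _); rewrite cF.
- by have [F cF] := prime_power_finField pp;
    rewrite -cF; apply: hadamard_order_paley1; rewrite cF.
- by have [F cF] := prime_power_finField pp;
    rewrite -cF; apply: hadamard_order_paley2; rewrite cF.
Qed.

Theorem theorem4p4 (R : rcfType) (s : nat) (H : signed_graph s) (mu : R)
    (n : nat) (B : signed_graph n)
    (hH : totally_disconnected H)
    (hmu : mu ^+ 2 = s%:R) (hs : (2 <= s)%N)
    (hB : maximal_bipartite B H mu) :
  (odd s -> switching_isomorphic B (positive_star s)) /\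
  ((2 %| s)%N -> ~~ (4 %| s)%N ->
     switching_isomorphic B (K2s_half_star s)) /\
  (in_NH s ->
     exists G : signed_graph (2 * s),
       [/\ bipartite G, strongly_regular G s 0 0 0
         & switching_isomorphic B G]).
Proof.
have s_gt0 := ltnW hs.
have [bipB scB maxB] := hB.
have [k [N [f [k_gt0 oN bf E]]]] :=
  star_complement_signed_Kpq hH hmu s_gt0 bipB scB.
have cn : n = (k + s)%N by rewrite -(card_ord n) -(bij_eq_card bf) card_ord.
(* Every signed K_{k',s} with orthogonal rows competes with B. *)
have max_k k' (N' : 'I_k' -> 'I_s -> bool) :
    (0 < k')%N -> orthogonal_rows N' -> (k' <= k)%N.
  move=> k'_gt0 oN'; rewrite -(leq_add2r s) -cn.
  apply: maxB (bipartite_signed_Kpq N') _.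
  exact: has_star_complement_signed_Kpq.
split=> [os | ]; last split=> [s2 s4 | NHs].
- have k1 : k = 1%N.
    apply/eqP; rewrite eqn_leq k_gt0 andbT leqNgt; apply/negP => k2.
    have /negP := @orthogonal_rows2 _ _ _ oN (Ordinal k_gt0) (Ordinal k2) isT.
    by rewrite card_ord.
  subst k.
  apply: (switching_isomorphic_signed_Kpq (g := id) (r := fun=> false)
    (c := fun j => N 0 j) bf E) => // i j.
  by rewrite (ord1 i).
- have es : ~~ odd s by rewrite -dvdn2.
  have k2 : k = 2%N.
    have le2 := max_k 2%N _ isT (K2s_orthogonal_rows es).
    apply/eqP; rewrite eqn_leq le2 andbT leqNgt; apply/negP => k3.
    case/negP: s4.
    have := @orthogonal_rows3 _ _ _ oN (Ordinal k_gt0) (Ordinal le2)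
      (Ordinal k3) isT isT isT.
    by rewrite card_ord.
  subst k.
  have [g ig gA] := exists_initial_segment [set j | N 0 j (+) N 1 j].
  rewrite orthogonal_rows_balanced // in gA.
  (* Switching the columns makes row 1 positive; the negative entries of row 0
     are then where the two rows of N differ, and g moves them to the front. *)
  apply: (switching_isomorphic_signed_Kpq (g := g) (r := fun=> false)
    (c := fun j => N 1 (g j)) bf E) => // i j.
  rewrite addbF -gA inE.
  case: i => [[|[|//]] Hi] /=; last by congr (N _ _); apply/val_inj.
  by rewrite addbK; congr (N _ _); apply/val_inj.
- have [N' oN'] := hadamard_order_orthogonal_rows (in_NH_hadamard_order NHs).
  have ks : k = s.
    apply/eqP; rewrite eqn_leq (orthogonal_rows_le s_gt0 oN).
    by rewrite (max_k _ _ s_gt0 oN').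
  subst k.
  suff W m : m = (s + s)%N -> exists G : signed_graph m,
     [/\ bipartite G, strongly_regular G s 0 0 0 & switching_isomorphic B G].
    by apply: W; rewrite mul2n addnn.
  move=> ->; exists (signed_Kpq N); split.
  + exact: bipartite_signed_Kpq.
  + exact: signed_Kpq_strongly_regular.
  apply: (switching_isomorphic_signed_Kpq (g := id) (r := fun=> false)
    (c := fun=> false) bf E) => // i j.
  by rewrite !addbF.
Qed.
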